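(* There do not exist a constant $C\ge 1$, integers $m(n)\in\mathbb{N}$ and maps $f_n: V(L_n)\to V(D_{m(n)})$ ($n\in\mathbb{N}$) such that each $f_n$ is a $C$-bilipschitz embedding, i.e. for each $n$ there is $r_n>0$ with $r_n\, d_{L_n}(u,v)\le d_{D_{m(n)}}(f_n u,f_n v)\le C r_n\, d_{L_n}(u,v)$ for all $u,v\in V(L_n)$. In other words, the sequence of Laakso graphs does not admit uniformly bilipschitz embeddings into the sequence of diamond graphs.
   Context: All graphs carry the shortest-path metric on their vertex sets; edges have length $1$ (the statement is the same for the weighted normalizations below, since rescaling does not affect distortion). Diamond graphs: $D_0$ consists of two vertices joined by an edge; $D_n$ is obtained from $D_{n-1}$ by replacing every edge $uv$ by a quadrilateral $u,a,v,b$ with edges $ua,av,vb,bu$ ($a,b$ new vertices). Laakso graphs: $L_0$ consists of two vertices joined by an edge; $L_1$ is the graph with vertices $x_1,\dots,x_6$ and edges $x_1x_2, x_2x_3, x_2x_4, x_3x_5, x_4x_5, x_5x_6$ (a path of length 1, then a 4-cycle $x_2x_3x_5x_4$, then a path of length 1); $L_n$ is obtained from $L_{n-1}$ by replacing every edge $uv$ by a copy of $L_1$, with $u$ and $v$ identified with the two degree-one vertices $x_1,x_6$ of $L_1$. *)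

(* Defs.v *)
From mathcomp Require Import all_boot all_order all_algebra.
From mathcomp Require Import reals.
Set Implicit Arguments. Unset Strict Implicit. Unset Printing Implicit Defensive.

(* A finite undirected graph: vertices 0, ..., nv-1, and a list of edges. *)
Record graph := Graph { nv : nat; es : seq (nat * nat) }.

Definition adj (G : graph) (x y : nat) : bool :=
  ((x, y) \in es G) || ((y, x) \in es G).

Fixpoint ball (G : graph) (k : nat) (x : nat) : seq nat :=
  match k with
  | 0 => [:: x]
  | k'.+1 => let B := ball G k' x in
             B ++ [seq y <- iota 0 (nv G) | has (fun z => adj G z y) B]
  end.

(* Shortest-path distance (edges of length 1): the least k with
   y within k steps of x.  (For a connected graph on nv vertices this is
   always < nv; unreachable pairs would get value nv, which never happens
   for the connected graphs below.) *)
Definition gdist (G : graph) (x y : nat) : nat :=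
  find (fun k => y \in ball G k x) (iota 0 (nv G)).

(* Diamond graphs: D_0 = single edge 0-1; D_n from D_(n-1) by replacing the
   i-th edge uv by the 4-cycle u,a,v,b with fresh a = N+2i, b = N+2i+1. *)
Fixpoint diamond_edges (N : nat) (i : nat) (s : seq (nat * nat)) :
    seq (nat * nat) :=
  match s with
  | [::] => [::]
  | (u, v) :: s' =>
      let a := N + 2 * i in let b := N + 2 * i + 1 in
      [:: (u, a); (a, v); (v, b); (b, u)] ++ diamond_edges N i.+1 s'
  end.

Definition diamond_step (G : graph) : graph :=
  Graph (nv G + 2 * size (es G)) (diamond_edges (nv G) 0 (es G)).

Definition diamond (n : nat) : graph := iter n diamond_step (Graph 2 [:: (0, 1)]).

(* Laakso graphs: L_0 = single edge 0-1; L_n from L_(n-1) by replacing the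
   i-th edge uv by a copy of L_1 (u = x1, v = x6) with fresh vertices
   x2 = N+4i, x3 = N+4i+1, x4 = N+4i+2, x5 = N+4i+3 and edges
   x1x2, x2x3, x2x4, x3x5, x4x5, x5x6. *)
Fixpoint laakso_edges (N : nat) (i : nat) (s : seq (nat * nat)) :
    seq (nat * nat) :=
  match s with
  | [::] => [::]
  | (u, v) :: s' =>
      let x2 := N + 4 * i in let x3 := N + 4 * i + 1 in
      let x4 := N + 4 * i + 2 in let x5 := N + 4 * i + 3 in
      [:: (u, x2); (x2, x3); (x2, x4); (x3, x5); (x4, x5); (x5, v)]
        ++ laakso_edges N i.+1 s'
  end.

Definition laakso_step (G : graph) : graph :=
  Graph (nv G + 4 * size (es G)) (laakso_edges (nv G) 0 (es G)).

Definition laakso (n : nat) : graph := iter n laakso_step (Graph 2 [:: (0, 1)]).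

Example laakso1_nv : nv (laakso 1) = 6. Proof. by []. Qed.
Example diamond1_dist : gdist (diamond 1) 0 1 = 2. Proof. by []. Qed.
Example laakso1_dist : gdist (laakso 1) 0 1 = 4. Proof. by []. Qed.
Example diamond2_nv : nv (diamond 2) = 12. Proof. by []. Qed.

(* Main.v *)
(** An embedding of distortion [C] would make some edge of a Laakso graph, seen
    at a coarse scale, stretched almost as much as any of its pieces at a much
    finer scale (otherwise the maximal stretch would decay geometrically through
    the scales).  On the copy [x1, ..., x6] of [L_1] replacing this edge, the map
    is then almost isometric along the geodesics from [x1] to [x6], while the two
    sides of the 4-cycle stay apart.  Pairs of poles of subdiamonds are cut pairs,
    so two such geodesics from [x2] to [x5] cannot both pass near the same vertex
    [w] unless [w] is close to [x2] or [x5]; descending to the smallest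
    subdiamond containing the images of [x2] and [x5], this forces them to lie
    close to the two poles of a subdiamond (the handle [x1 x2] excludes a rotated
    cycle).  Applying this also to the copy [y1, ..., y6] of [L_1] inside the edge
    [x2 x3], whose cycle is 4 times smaller, both [x2] and [y2] are mapped close to
    vertices whose mutual distances are multiples of [d(y2, y5)] up to small
    errors; but [y2] is at half that distance from [x2]. *)
Require Import Defs.
From mathcomp Require Import all_boot all_order all_algebra.
From mathcomp Require Import reals.
From mathcomp Require Import zify.
Import Order.TTheory GRing.Theory Num.Theory.
Local Open Scope nat_scope.

Local Notation dd m := (gdist (diamond m)).
Local Notation refine j G := (iter j laakso_step G).

(** * Shortest paths *)

Definition wfg (G : graph) : Prop :=
  forall u v, (u, v) \in es G -> u < nv G /\ v < nv G.

Definition reach (G : graph) (x : nat) : Prop :=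
  exists2 p, path (adj G) 0 p & last 0 p = x.

Definition connected (G : graph) : Prop := forall x, x < nv G -> reach G x.

Lemma reach_adj G x y : reach G x -> adj G x y -> reach G y.
Proof.
move=> [p pp lp] xy; exists (rcons p y); last by rewrite last_rcons.
by rewrite rcons_path pp lp.
Qed.

Lemma reach_refine G G' x :
  (forall u v, adj G u v -> reach G' u -> reach G' v) ->
  reach G x -> reach G' x.
Proof.
move=> GG' [p pp <-]; elim/last_ind: p pp => [|p z IHp]; first by exists [::].
by rewrite rcons_path last_rcons => /andP[/IHp rp /GG']; apply.
Qed.

Lemma adjC G x y : adj G x y = adj G y x.
Proof. by rewrite /adj orbC. Qed.

Lemma adj_bound G x y : wfg G -> adj G x y -> x < nv G /\ y < nv G.
Proof. by move=> wG /orP[] /wG[]. Qed.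

Lemma ball_path G k x y : y \in ball G k x ->
  exists p, [/\ path (adj G) x p, last x p = y & size p <= k].
Proof.
elim: k y => [|k IH] y /=.
  by rewrite inE => /eqP->; exists [::].
rewrite mem_cat => /orP[/IH[p [pp lp sp]]|].
  by exists p; split=> //; lia.
rewrite mem_filter => /andP[/hasP[z /IH[p [pp lp sp]] zy] _].
by exists (rcons p y); rewrite rcons_path last_rcons size_rcons pp lp.
Qed.

Lemma path_ball G x p : wfg G -> path (adj G) x p ->
  last x p \in ball G (size p) x.
Proof.
move=> wG; elim/last_ind: p => [|p y IH] /=; first by rewrite inE.
rewrite rcons_path last_rcons size_rcons /= => /andP[/IH lp lpy].
rewrite mem_cat; apply/orP; right; rewrite mem_filter mem_iota add0n.
rewrite leq0n (adj_bound _ _ _ wG lpy).2 !andbT; apply/hasP.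
by exists (last x p).
Qed.

Lemma gdist_le G x p : wfg G -> path (adj G) x p ->
  gdist G x (last x p) <= size p.
Proof.
move=> wG pp; rewrite /gdist; case: (ltnP (size p) (nv G)) => sp; last first.
  by apply: leq_trans (find_size _ _) _; rewrite size_iota.
rewrite leqNgt; apply/negP => /(before_find 0).
by rewrite nth_iota // add0n path_ball.
Qed.

Lemma adj_gdist G x y : wfg G -> adj G x y -> gdist G x y <= 1.
Proof. by move=> wG xy; apply: (gdist_le G x [:: y]) => //=; rewrite xy. Qed.

Lemma rev_adj_path G x p : path (adj G) x p ->
  exists q, [/\ path (adj G) (last x p) q, last (last x p) q = x & size q = size p].
Proof.
move=> pp; exists (rev (belast x p)); split.
- rewrite rev_path; apply: sub_path pp => u v /=.
  by rewrite adjC.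
- by case: p {pp} => //= y p; rewrite rev_cons last_rcons.
- by rewrite size_rev size_belast.
Qed.

(** A walk from [x] to [y] through vertex 0 shortens to a path without repetition, which has fewer
    than [nv G] edges. So the search defining [gdist] stops before its default value [nv G], and the
    ball found yields a path of that length. *)
Lemma gdist_path G x y : wfg G -> connected G -> x < nv G -> y < nv G ->
  exists p, [/\ path (adj G) x p, last x p = y & size p = gdist G x y].
Proof.
move=> wG cG xG yG.
have [p pp lp] : exists2 p, path (adj G) x p & last x p = y.
  have [p p0 px] := cG _ xG; have [q q0 qy] := cG _ yG.
  have [p' [h1 h2 _]] := rev_adj_path _ _ _ p0; rewrite px in h1 h2.
  by exists (p' ++ q); rewrite ?cat_path ?last_cat h2 ?h1.
move: lp; case/shortenP: pp => {}p pp up _ lp.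
have sp : size p < nv G.
  have -> : (size p).+1 = size (x :: p) by [].
  rewrite -[nv G](size_iota 0); apply: uniq_leq_size => // z.
  rewrite mem_iota add0n leq0n /= inE => /orP[/eqP->//|].
  elim: p x pp {up lp xG} => //= a p IH x /andP[xa pa].
  by rewrite inE => /orP[/eqP->|/(IH a pa)//]; apply: (adj_bound _ _ _ wG xa).2.
have hh : has (fun k => y \in ball G k x) (iota 0 (nv G)).
  by apply/hasP; exists (size p); rewrite ?mem_iota // -lp path_ball.
have := hh; rewrite has_find size_iota => lt.
have := nth_find 0 hh; rewrite nth_iota // add0n => /ball_path[q [pq lq sq]].
exists q; split=> //; apply/eqP; rewrite eqn_leq sq /=.
by rewrite -lq; apply: gdist_le.
Qed.

Lemma gdistxx G x : x < nv G -> gdist G x x = 0.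
Proof. by rewrite /gdist; case: (nv G) => //= n _; rewrite inE eqxx. Qed.

Lemma gdist_tri G x y z : wfg G -> connected G ->
  x < nv G -> y < nv G -> z < nv G ->
  gdist G x z <= gdist G x y + gdist G y z.
Proof.
move=> wG cG xG yG zG; have [p [pp lp <-]] := gdist_path _ _ _ wG cG xG yG.
have [q [pq lq <-]] := gdist_path _ _ _ wG cG yG zG.
rewrite -size_cat -lq -lp -last_cat; apply: gdist_le => //.
by rewrite cat_path pp lp pq.
Qed.

Lemma gdistC G x y : wfg G -> connected G -> x < nv G -> y < nv G ->
  gdist G x y = gdist G y x.
Proof.
move=> wG cG; have le u v : u < nv G -> v < nv G -> gdist G u v <= gdist G v u.
  move=> uG vG; have [p [pp lp <-]] := gdist_path _ _ _ wG cG vG uG.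
  have [q [pq lq sq]] := rev_adj_path _ _ _ pp.
  by have := gdist_le _ _ _ wG pq; rewrite lq lp sq.
by move=> xG yG; apply/eqP; rewrite eqn_leq !le.
Qed.

Definition lip (G : graph) (g : nat -> nat) : Prop :=
  forall u v, (u, v) \in es G -> g u <= (g v).+1 /\ g v <= (g u).+1.

Lemma gdist_lip G g x y : wfg G -> connected G -> lip G g ->
  x < nv G -> y < nv G -> g x <= g y + gdist G x y.
Proof.
move=> wG cG lG xG yG; have [p [pp <- <-]] := gdist_path _ _ _ wG cG xG yG.
elim: p x pp {xG} => [|a p IH] x /=; first by rewrite addn0.
by move=> /andP[xa /IH]; case/orP: xa => /lG[]; lia.
Qed.

Lemma gdist_self_lip G x : wfg G -> connected G -> x < nv G ->
  lip G (gdist G x).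
Proof.
move=> wG cG xG u v uv; have [uG vG] := wG _ _ uv.
have d1 : gdist G u v <= 1 by apply: adj_gdist => //; rewrite /adj uv.
have := gdist_tri _ x u v wG cG xG uG vG.
have := gdist_tri _ x v u wG cG xG vG uG.
rewrite (gdistC _ v u wG cG) //; lia.
Qed.

(** On a shortest path from [x], the first vertex whose successor leaves [B] must be [p] or [q], and
    it splits the length. *)
Lemma gdist_cut G (B : pred nat) p q x y : wfg G -> connected G ->
  (forall u v, adj G u v -> B u -> ~~ B v -> u = p \/ u = q) ->
  x < nv G -> y < nv G -> B x -> ~~ B y ->
  [/\ p < nv G & gdist G x p + gdist G p y <= gdist G x y] \/
  [/\ q < nv G & gdist G x q + gdist G q y <= gdist G x y].
Proof.
move=> wG cG cut xG yG Bx By; have [r [pr lr <-]] := gdist_path _ _ _ wG cG xG yG.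
suff [w [wn wpq le]] : exists w, [/\ w < nv G, w = p \/ w = q &
    gdist G x w + gdist G w y <= size r].
  by case: wpq le wn => ->; [left|right].
elim: r x pr lr xG Bx => [|a r IH] x /=; first by move=> _ -> _; rewrite (negPf By).
move=> /andP[xa pr] lr xG Bx; have [_ aG] := adj_bound _ _ _ wG xa.
case: (boolP (B a)) => [/(IH a pr lr aG)[w [wn wpq le]]|/(cut _ _ xa Bx) xpq].
  exists w; split=> //; have := gdist_tri _ _ _ _ wG cG xG aG wn.
  by have := adj_gdist _ _ _ wG xa; lia.
exists x; split=> //; rewrite gdistxx // add0n -lr.
by apply: (gdist_le _ _ (a :: r)) => //=; rewrite xa.
Qed.

(** * Diamond graphs *)

Definition de (m j : nat) : nat * nat := nth (0, 0) (es (diamond m)) j.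

Lemma size_diamond_edges N i s : size (diamond_edges N i s) = 4 * size s.
Proof. by elim: s i => //= -[u v] s IH i; rewrite /= IH; lia. Qed.

Lemma size_es_diamond m : size (es (diamond m)) = 4 ^ m.
Proof. by elim: m => //= m IH; rewrite size_diamond_edges IH expnS. Qed.

Lemma nth_diamond_edges N i s j r : j < size s -> r < 4 ->
  nth (0, 0) (diamond_edges N i s) (4 * j + r) =
  let: (u, v) := nth (0, 0) s j in let a := N + 2 * (i + j) in
  nth (0, 0) [:: (u, a); (a, v); (v, a.+1); (a.+1, u)] r.
Proof.
move=> js r4; elim: s i j js => //= -[u v] s IH i [|j] js.
  by rewrite muln0 add0n addn0 addn1 /=; case: r r4 {IH} => [|[|[|[|]]]].
have -> : 4 * j.+1 + r = (4 * j + r).+4 by lia.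
by rewrite /= IH // addSnnS.
Qed.

(** Positions encode ancestry: edge [j] becomes the edges [4 * j + r], where [r] = 0, 1 run through
    the new vertex [a] and [r] = 2, 3 through [a.+1]. Ancestors are thus found by dividing by powers
    of 4. *)
Lemma deS m j (u := (de m j).1) (v := (de m j).2) (a := nv (diamond m) + 2 * j) :
  j < 4 ^ m ->
  [/\ de m.+1 (4 * j) = (u, a), de m.+1 (4 * j + 1) = (a, v),
      de m.+1 (4 * j + 2) = (v, a.+1) & de m.+1 (4 * j + 3) = (a.+1, u)].
Proof.
rewrite -size_es_diamond => jm.
have E r : r < 4 -> de m.+1 (4 * j + r) =
    nth (0, 0) [:: (u, a); (a, v); (v, a.+1); (a.+1, u)] r.
  move=> r4; rewrite /de /= nth_diamond_edges //.
  by rewrite /u /v /a /de; case: (nth _ _ j).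
by split; rewrite ?E // -[4 * j]addn0 E.
Qed.

Lemma nv_diamondS m : nv (diamond m.+1) = nv (diamond m) + 2 * 4 ^ m.
Proof. by rewrite /= size_es_diamond. Qed.

(* Edge [j] of [D_(m+1)] subdivides edge [j %/ 4] of [D_m]. *)
Lemma de_cases m j : j < 4 ^ m.+1 -> let i := j %/ 4 in
  i < 4 ^ m /\ [\/ j = 4 * i, j = 4 * i + 1, j = 4 * i + 2 | j = 4 * i + 3].
Proof.
rewrite expnS => jm i; split; first by lia.
have [|[|[|]]] : j = 4 * i \/ j = 4 * i + 1 \/ j = 4 * i + 2 \/ j = 4 * i + 3.
  by lia.
all: by [constructor 1|constructor 2|constructor 3|constructor 4].
Qed.

Lemma de_bound m j : j < 4 ^ m ->
  (de m j).1 < nv (diamond m) /\ (de m j).2 < nv (diamond m).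
Proof.
elim: m j => [|m IH] j; first by case: j.
move=> /de_cases; set i := j %/ 4 => -[/[dup] im /[dup] /IH b /deS[e0 e1 e2 e3]].
rewrite nv_diamondS; case=> ->; rewrite ?e0 ?e1 ?e2 ?e3 /=; lia.
Qed.

Lemma mem_diamond m u v : (u, v) \in es (diamond m) ->
  exists2 j, j < 4 ^ m & de m j = (u, v).
Proof. by move=> /(nthP (0, 0))[j]; rewrite size_es_diamond; exists j. Qed.

Lemma de_mem m j : j < 4 ^ m -> de m j \in es (diamond m).
Proof. by move=> jm; rewrite mem_nth // size_es_diamond. Qed.

Lemma wf_diamond m : wfg (diamond m).
Proof. by move=> u v /mem_diamond[j /de_bound + jE]; rewrite jE. Qed.

Definition dend (m j x : nat) : Prop := x = (de m j).1 \/ x = (de m j).2.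

Lemma adj_diamond m u v : adj (diamond m) u v ->
  exists j, [/\ j < 4 ^ m, dend m j u & dend m j v].
Proof.
rewrite /dend => /orP[] /mem_diamond[j jm jE]; exists j; rewrite jE; split=> //=; auto.
Qed.

Lemma dend_new m j : j < 4 ^ m.+1 -> exists e,
  [/\ e < 2, dend m.+1 j (nv (diamond m) + 2 * (j %/ 4) + e) &
  forall x, dend m.+1 j x -> x = nv (diamond m) + 2 * (j %/ 4) + e \/
    x < nv (diamond m) /\ dend m (j %/ 4) x].
Proof.
rewrite /dend => /de_cases; set i := j %/ 4 => -[im].
have [b1 b2] := de_bound _ _ im; have [e0 e1 e2 e3] := deS _ _ im.
case=> ->; rewrite ?e0 ?e1 ?e2 ?e3 /=; [exists 0|exists 0|exists 1|exists 1];
  split=> //; try (by rewrite ?addn0 ?addn1; auto);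
  move=> x [] ->; lia.
Qed.

Lemma dend_old m j x : j < 4 ^ m -> dend m j x ->
  exists2 r, r < 4 & dend m.+1 (4 * j + r) x.
Proof.
rewrite /dend => /deS[e0 e1 _ _] [->|->]; [exists 0|exists 1] => //.
  by rewrite addn0 e0; left.
by rewrite e1; right.
Qed.

Lemma vertex_dend m x : x < nv (diamond m) -> exists2 j, j < 4 ^ m & dend m j x.
Proof.
elim: m x => [|m IH] x.
  by case: x => [|[|]] // _; exists 0 => //; [left|right].
have [|xm] := ltnP x (nv (diamond m)).
  move=> /IH[j jm /(dend_old _ _ _ jm)[r r4 xj]] _; exists (4 * j + r) => //.
  by rewrite expnS; lia.
rewrite nv_diamondS => xm'; pose j := (x - nv (diamond m)) %/ 2.
have jm : j < 4 ^ m by lia.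
have [_ e1 _ e3] := deS _ _ jm; rewrite /dend.
have [] : x = nv (diamond m) + 2 * j \/ x = (nv (diamond m) + 2 * j).+1 by lia.
  by exists (4 * j + 1); rewrite ?e1 ?expnS //=; [lia|left].
by exists (4 * j + 3); rewrite ?e3 ?expnS //=; [lia|left].
Qed.

Lemma de_adj m j : j < 4 ^ m ->
  let: (u, v) := de m j in adj (diamond m) u v && adj (diamond m) v u.
Proof.
by move=> /de_mem; case: (de _ _) => u v uv; rewrite /adj uv orbT.
Qed.

Lemma adj_mid m u v : adj (diamond m) u v ->
  exists2 w, adj (diamond m.+1) u w & adj (diamond m.+1) w v.
Proof.
move=> uv; have [j [jm]] : exists j, j < 4 ^ m /\ (de m j = (u, v) \/ de m j = (v, u)).
  by case/orP: uv => /mem_diamond[j jm jE]; exists j; auto.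
have [e0 e1 _ _] := deS _ _ jm; case=> jE; rewrite jE /= in e0 e1;
have := de_adj m.+1 (4 * j); have := de_adj m.+1 (4 * j + 1); rewrite e0 e1 expnS => h1 h0;
have /andP[h1a h1b] := h1 ltac:(lia); have /andP[h0a h0b] := h0 ltac:(lia).
  by exists (nv (diamond m) + 2 * j).
by exists (nv (diamond m) + 2 * j).
Qed.

Lemma conn_diamond m : connected (diamond m).
Proof.
elim: m => [|m IH] x.
  by case: x => [|[|]] //= _; [exists [::]|exists [:: 1]].
have old y : y < nv (diamond m) -> reach (diamond m.+1) y.
  move=> /IH; apply: reach_refine => u v /adj_mid[w uw wv] ru.
  exact: reach_adj _ _ _ (reach_adj _ _ _ ru uw) wv.
move=> xm; have [/old//|xm'] := ltnP x (nv (diamond m)).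
have [j jm xj] := vertex_dend _ _ xm; have := de_cases _ _ jm.
set i := j %/ 4 => -[im jE]; have [u v] := de_bound _ _ im.
have [e0 e1 e2 e3] := deS _ _ im; have := de_adj _ _ jm.
case: jE xj => -> []; rewrite ?e0 ?e1 ?e2 ?e3 /= => xE /andP[h1 h2]; try lia;
  (apply: reach_adj; last by rewrite xE; first [exact: h1|exact: h2]); exact: old.
Qed.


Lemma dd_tri m x y z : x < nv (diamond m) -> y < nv (diamond m) ->
  z < nv (diamond m) -> dd m x z <= dd m x y + dd m y z.
Proof. exact: gdist_tri _ _ _ _ (wf_diamond m) (conn_diamond m). Qed.

Lemma ddC m x y : x < nv (diamond m) -> y < nv (diamond m) -> dd m x y = dd m y x.
Proof. exact: gdistC _ _ _ (wf_diamond m) (conn_diamond m). Qed.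

Lemma nv_diamond_le k t : nv (diamond k) <= nv (diamond (k + t)).
Proof. by elim: t => [|t IH]; rewrite ?addn0 // addnS nv_diamondS; lia. Qed.

(** * Distances under subdivision of diamond graphs *)

Definition diamond_ext m (g : nat -> nat) (x : nat) : nat :=
  if x < nv (diamond m) then 2 * g x
  else let: (u, v) := de m ((x - nv (diamond m)) %/ 2) in g u + g v.

Lemma lip_diamond_ext m g : lip (diamond m) g ->
  lip (diamond m.+1) (diamond_ext m g).
Proof.
move=> lg u v /mem_diamond[j /de_cases]; set i := j %/ 4 => -[im].
have [b1 b2] := de_bound _ _ im; have [e0 e1 e2 e3] := deS _ _ im.
have := de_mem _ _ im; case iE: (de m i) b1 b2 e0 e1 e2 e3 => [a b] /= b1 b2 e0 e1 e2 e3 /lg ab.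
have E0 : diamond_ext m g (nv (diamond m) + 2 * i) = g a + g b.
  by rewrite /diamond_ext ltnNge leq_addr addKn mulKn //= iE.
have E1 : diamond_ext m g (nv (diamond m) + 2 * i).+1 = g a + g b.
  rewrite /diamond_ext ltnNge -addnS leq_addr addKn /=.
  by have -> : (2 * i).+1 %/ 2 = i by [lia]; rewrite iE.
have Ea : diamond_ext m g a = 2 * g a by rewrite /diamond_ext b1.
have Eb : diamond_ext m g b = 2 * g b by rewrite /diamond_ext b2.
case=> ->; rewrite ?e0 ?e1 ?e2 ?e3 => -[<- <-]; rewrite ?E0 ?E1 ?Ea ?Eb; lia.
Qed.

Lemma path_double m x p : path (adj (diamond m)) x p -> exists q,
  [/\ path (adj (diamond m.+1)) x q, last x q = last x p & size q = 2 * size p].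
Proof.
elim: p x => [|z p IH] x; first by exists [::].
move=> /= /andP[/adj_mid[w xw wz] /IH[q [pq lq sq]]].
by exists [:: w, z & q]; split=> //=; [rewrite xw wz|rewrite sq mulnS].
Qed.

(** Subdividing doubles paths, which gives the upper bound. For the lower bound, [diamond_ext]
    doubles the distance from [x] on old vertices, takes the sum over the ends of the parent edge on
    new ones, and stays 1-Lipschitz. *)
Lemma ddS m x y : x < nv (diamond m) -> y < nv (diamond m) ->
  dd m.+1 x y = 2 * dd m x y.
Proof.
move=> xm ym; have le z : z < nv (diamond m) -> z < nv (diamond m.+1).
  by rewrite nv_diamondS; lia.
have wG := wf_diamond m; have cG := conn_diamond m.
apply/eqP; rewrite eqn_leq; apply/andP; split.
  have [p [/path_double[q [pq lq sq]] lp <-]] := gdist_path _ _ _ wG cG xm ym.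
  by rewrite -sq -lp -lq; apply: gdist_le pq; apply: wf_diamond.
have lg := lip_diamond_ext _ _ (gdist_self_lip _ x wG cG xm).
have := gdist_lip _ _ y x (wf_diamond m.+1) (conn_diamond m.+1) lg (le _ ym) (le _ xm).
rewrite /diamond_ext xm ym gdistxx // (ddC m.+1 y x) ?le //; lia.
Qed.

Lemma dd_scale k t x y : x < nv (diamond k) -> y < nv (diamond k) ->
  dd (k + t) x y = 2 ^ t * dd k x y.
Proof.
move=> xk yk; elim: t => [|t IH]; first by rewrite addn0 mul1n.
have le z : z < nv (diamond k) -> z < nv (diamond (k + t)).
  by move=> /leq_trans; apply; apply: nv_diamond_le.
by rewrite addnS ddS ?le // IH expnS mulnA.
Qed.

Lemma de_neq m j : j < 4 ^ m -> (de m j).1 != (de m j).2.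
Proof.
case: m j => [|m] j; first by case: j.
move=> /de_cases; set i := j %/ 4 => -[im].
have [b1 b2] := de_bound _ _ im; have [e0 e1 e2 e3] := deS _ _ im.
by case=> ->; rewrite ?e0 ?e1 ?e2 ?e3 /=; lia.
Qed.

Lemma dd_de m j : j < 4 ^ m -> dd m (de m j).1 (de m j).2 = 1.
Proof.
move=> jm; have := de_neq _ _ jm; have := de_adj _ _ jm.
have := de_bound _ _ jm; case: (de m j) => u v /= [um vm] /andP[uv _] /eqP nuv.
have := adj_gdist _ _ _ (wf_diamond m) uv.
have [p [_ + <-]] := gdist_path _ _ _ (wf_diamond m) (conn_diamond m) um vm.
by case: p => [/nuv//|a [|b p]].
Qed.

(** * Blocks of edges and their cut pairs *)

Definition covers m (B : pred nat) (x : nat) : bool :=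
  has (fun j => B j && ((x == (de m j).1) || (x == (de m j).2)))
    (iota 0 (4 ^ m)).

Lemma coversP m (B : pred nat) x : reflect
  (exists j, [/\ j < 4 ^ m, B j & dend m j x]) (covers m B x).
Proof.
apply: (iffP hasP) => [[j]|[j [jm ji jx]]].
  rewrite mem_iota => /= jm /andP[ji /orP jx]; exists j; split=> //.
  by case: jx => /eqP; [left|right].
exists j; first by rewrite mem_iota.
by rewrite ji; case: jx => ->; rewrite eqxx ?orbT.
Qed.

Lemma dend_bound m j x : j < 4 ^ m -> dend m j x -> x < nv (diamond m).
Proof. by move=> /de_bound[b1 b2] []->. Qed.

Definition separated m (B : pred nat) p q : Prop := forall j1 j2 x,
  j1 < 4 ^ m -> j2 < 4 ^ m -> B j1 -> ~~ B j2 ->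
  dend m j1 x -> dend m j2 x -> x = p \/ x = q.

(** A new vertex meets only edges with the same parent, so subdividing creates no new boundary
    vertex. *)
Lemma separatedS m B p q : separated m B p q ->
  separated m.+1 (fun j => B (j %/ 4)) p q.
Proof.
move=> sB j1 j2 x j1m j2m B1 B2 x1 x2.
have [i1m _] := de_cases _ _ j1m; have [i2m _] := de_cases _ _ j2m.
have [e1 [e1l _ /(_ _ x1) h1]] := dend_new _ _ j1m.
have [e2 [e2l _ /(_ _ x2) h2]] := dend_new _ _ j2m.
case: h1 h2 => [h1|[h1 h1']] [h2|[h2 h2']]; try lia.
  by have E : j1 %/ 4 = j2 %/ 4 by [lia]; rewrite E (negPf B2) in B1.
exact: sB h1' h2'.
Qed.

Lemma separated_iter k t B p q : separated k B p q ->
  separated (k + t) (fun j => B (j %/ 4 ^ t)) p q.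
Proof.
move=> sB; elim: t => [|t IH].
  by rewrite addn0 => j1 j2 x; rewrite !divn1; apply: sB.
rewrite addnS => j1 j2 x j1m j2m; rewrite /= expnS !divnMA.
exact: (separatedS _ _ _ _ IH _ _ _ j1m j2m).
Qed.

Lemma dd_cut m B p q x y : separated m B p q ->
  covers m B x -> y < nv (diamond m) -> ~~ covers m B y ->
  [/\ p < nv (diamond m) & dd m x p + dd m p y <= dd m x y] \/
  [/\ q < nv (diamond m) & dd m x q + dd m q y <= dd m x y].
Proof.
move=> sB Bx ym By; have [j [jm _ /(dend_bound _ _ _ jm) xm]] := coversP _ _ _ Bx.
apply: gdist_cut (wf_diamond m) (conn_diamond m) _ xm ym Bx By => u v.
move=> /adj_diamond[j2 [j2m j2u j2v]] /coversP[j1 [j1m Bj1 j1u]] Bv.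
apply: (sB _ _ _ j1m j2m Bj1 _ j1u j2u).
by apply: contra Bv => Bj2; apply/coversP; exists j2.
Qed.

(* The edges of [D_(k+t)] into which edge [i] of [D_k] is subdivided. *)
Definition block t i : pred nat := fun j => j %/ 4 ^ t == i.

Lemma separated_block k t i : separated (k + t) (block t i) (de k i).1 (de k i).2.
Proof.
apply: (separated_iter k t (pred1 i)) => j1 j2 x _ _ /eqP-> _ x1 _.
exact: x1.
Qed.

(** [h] is the height of edge [j] above the first pole of its block. Subdividing an edge doubles the
    height, and adds 1 for the halves in the upper position. *)
Lemma block_height k t i j : i < 4 ^ k -> j < 4 ^ (k + t) -> j %/ 4 ^ t = i ->
  exists h, exists lo hi, [/\ h < 2 ^ t, de (k + t) j = (lo, hi) \/ de (k + t) j = (hi, lo),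
    dd (k + t) (de k i).1 lo <= h & dd (k + t) hi (de k i).2 <= 2 ^ t - h.+1].
Proof.
move=> ik; elim: t j => [|t IH] j.
  rewrite addn0 divn1 => jm ->; exists 0, (de k i).1, (de k i).2.
  have [b1 b2] := de_bound _ _ ik.
  by rewrite !gdistxx // -surjective_pairing; split=> //; left.
rewrite addnS [4 ^ t.+1]expnS [2 ^ t.+1]expnS divnMA => /de_cases; move: (j %/ 4) => j' [j'm jE].
move=> /(IH _ j'm)[h [lo [hi [hl lohi dlo dhi]]]].
have [p0 q0] := de_bound _ _ ik.
have le z : z < nv (diamond k) -> z < nv (diamond (k + t)).
  by move=> /leq_trans; apply; apply: nv_diamond_le.
have [lb hb] : lo < nv (diamond (k + t)) /\ hi < nv (diamond (k + t)).
  by have [b1 b2] := de_bound _ _ j'm; case: lohi b1 b2 => ->.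
set m := k + t in le lb hb lohi dlo dhi j'm *.
have up z : z < nv (diamond m) -> z < nv (diamond m.+1).
  by rewrite nv_diamondS; lia.
have pm0 := le _ p0; have qm0 := le _ q0.
have dlo' : dd m.+1 (de k i).1 lo <= 2 * h by rewrite ddS // leq_mul2l.
have dhi' : dd m.+1 hi (de k i).2 <= 2 * (2 ^ t - h.+1) by rewrite ddS // leq_mul2l.
suff [w [w_m lw wh jw]] : exists w, [/\ w < nv (diamond m.+1), dd m.+1 lo w <= 1,
    dd m.+1 w hi <= 1 & [\/ de m.+1 j = (lo, w), de m.+1 j = (w, lo),
       de m.+1 j = (w, hi) | de m.+1 j = (hi, w)]].
  have [pm qm] : (de k i).1 < nv (diamond m.+1) /\ (de k i).2 < nv (diamond m.+1).
    by split; apply/up/le.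
  have t1 := dd_tri m.+1 _ _ _ pm (up _ lb) w_m.
  have t2 := dd_tri m.+1 _ _ _ w_m (up _ hb) qm.
  case: jw => jw; rewrite jw.
  - by exists (2 * h), lo, w; split; [lia|left|lia|lia].
  - by exists (2 * h), lo, w; split; [lia|right|lia|lia].
  - by exists (2 * h).+1, w, hi; split; [lia|left|lia|lia].
  - by exists (2 * h).+1, w, hi; split; [lia|right|lia|lia].
have ae u v : (u, v) \in es (diamond m.+1) -> [/\ u < nv (diamond m.+1),
   v < nv (diamond m.+1), dd m.+1 u v <= 1 & dd m.+1 v u <= 1].
  move=> uv; have [um vm] := wf_diamond _ _ _ uv; split=> //;
  by apply: adj_gdist (wf_diamond _) _; rewrite /adj uv ?orbT.
have [e0 e1 e2 e3] := deS _ _ j'm.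
have [] : [/\ 4 * j' < 4 ^ m.+1, 4 * j' + 1 < 4 ^ m.+1, 4 * j' + 2 < 4 ^ m.+1
   & 4 * j' + 3 < 4 ^ m.+1] by rewrite expnS; split; lia.
move=> /de_mem + /de_mem + /de_mem + /de_mem; rewrite e0 e1 e2 e3.
move=> /ae[a0 b0 c0 d0] /ae[a1 b1 c1 d1] /ae[a2 b2 c2 d2] /ae[a3 b3 c3 d3].
case: lohi e0 e1 e2 e3 a0 b0 c0 d0 a1 b1 c1 d1 a2 b2 c2 d2 a3 b3 c3 d3 => -> /=;
set a := _ + _ => e0 e1 e2 e3 a0 b0 c0 d0 a1 b1 c1 d1 a2 b2 c2 d2 a3 b3 c3 d3;
case: jE => ->; rewrite ?e0 ?e1 ?e2 ?e3; [exists a|exists a|exists a.+1|exists a.+1|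
  exists a|exists a|exists a.+1|exists a.+1]; split=> //;
by [constructor 1|constructor 2|constructor 3|constructor 4].
Qed.

(** The heights from [block_height] bound the sum above by [2 ^ t]; the triangle inequality bounds
    it below, the poles being at distance [2 ^ t]. So all vertices of a subdiamond lie on geodesics
    between its poles. *)
Lemma block_dist k t i x (p := (de k i).1) (q := (de k i).2) : i < 4 ^ k ->
  covers (k + t) (block t i) x ->
  dd (k + t) p x + dd (k + t) x q = 2 ^ t.
Proof.
move=> ik /coversP[j [jm /eqP ji jx]]; have [pk qk] := de_bound _ _ ik.
have le z : z < nv (diamond k) -> z < nv (diamond (k + t)).
  by move=> /leq_trans; apply; apply: nv_diamond_le.
have pq : dd (k + t) p q = 2 ^ t by rewrite dd_scale // dd_de // muln1.
have xm := dend_bound _ _ _ jm jx.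
have tr := dd_tri (k + t) _ _ _ (le _ pk) xm (le _ qk).
have [h [lo [hi [hl jE dlo dhi]]]] := block_height k t i j ik jm ji.
have [lb hb lh hl1] : [/\ lo < nv (diamond (k + t)), hi < nv (diamond (k + t)),
    dd (k + t) lo hi <= 1 & x = lo \/ x = hi].
  have := dd_de _ _ jm; have := de_bound _ _ jm; rewrite /dend in jx.
  case: jE jx => -> /= jx [b1 b2] d1; split=> //; try lia.
  by rewrite ddC // d1.
have t1 := dd_tri (k + t) _ _ _ (le _ pk) lb hb.
have t2 := dd_tri (k + t) _ _ _ lb hb (le _ qk).
by rewrite -/p -/q in tr dlo dhi pq t1 t2 *; case: hl1 => ?; subst x; lia.
Qed.

(** * Subdiamonds *)

(** The new vertex in the middle of a side has only the two edges of that side, so a side meets the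
    other edges only at the ends of the parent edge. *)
Lemma separated_side k i : i < 4 ^ k ->
  separated k.+1 (fun j => (j == 4 * i) || (j == 4 * i + 1)) (de k i).1 (de k i).2 /\
  separated k.+1 (fun j => (j == 4 * i + 2) || (j == 4 * i + 3)) (de k i).1 (de k i).2.
Proof.
move=> ik; have [e0 e1 e2 e3] := deS _ _ ik; have [b1 b2] := de_bound _ _ ik.
split=> j1 j2 x j1k j2k /orP[] /eqP-> + ; rewrite /dend ?e0 ?e1 ?e2 ?e3 /= => + [] -> x2;
 auto; have := de_cases _ _ j2k; move: x2; set i2 := j2 %/ 4;
 move=> x2 [i2k]; have [f0 f1 f2 f3] := deS _ _ i2k; have [c1 c2] := de_bound _ _ i2k;
 move: x2 => /[swap] -[] ->; rewrite ?f0 ?f1 ?f2 ?f3 /=; lia.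
Qed.

(* [S] is the vertex set of the subdiamond of [D_m] grown from the edge [pq] of
   [D_k]; its poles [p] and [q] come in either order. *)
Definition cell m k t p q (S : pred nat) : Prop := k + t = m /\
  exists i, [/\ i < 4 ^ k, de k i = (p, q) \/ de k i = (q, p) & S = covers m (block t i)].

Lemma cellC m k t p q S : cell m k t p q S -> cell m k t q p S.
Proof. by case=> ktm [i [ik iE SE]]; split=> //; exists i; split; tauto. Qed.

Lemma cell_bound m k t p q S : cell m k t p q S ->
  [/\ k <= m, p < nv (diamond k), q < nv (diamond k), p < nv (diamond m) & q < nv (diamond m)].
Proof.
case=> <- [i [/de_bound[b1 b2] iE _]]; have := nv_diamond_le k t.
by case: iE b1 b2 => -> /=; rewrite leq_addr; split=> //; apply: leq_trans; eassumption.
Qed.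

Lemma cell_sub m k t p q S x : cell m k t p q S -> S x -> x < nv (diamond m).
Proof. by case=> _ [i [_ _ ->]] /coversP[j [jm _ /(dend_bound _ _ _ jm)]]. Qed.

Lemma cell_dist m k t p q S x : cell m k t p q S -> S x ->
  dd m p x + dd m q x = 2 ^ t.
Proof.
move=> cS Sx; have xm := cell_sub _ _ _ _ _ _ _ cS Sx.
have [_ _ _ pm qm] := cell_bound _ _ _ _ _ _ cS.
case: cS pm qm Sx xm => <- [i [ik iE ->]] pm qm Sx xm.
have := block_dist k t i x ik Sx; have := ddC _ _ _ xm pm; have := ddC _ _ _ xm qm.
by case: iE => -> /=; lia.
Qed.

Lemma cell_poles m k t p q S : cell m k t p q S -> dd m p q = 2 ^ t.
Proof.
move=> /[dup] /cell_bound[_ pk qk _ _] [<- [i [ik iE _]]].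
rewrite dd_scale //; have := dd_de _ _ ik; case: iE => -> /= => [->|]; first by rewrite muln1.
by rewrite ddC // => ->; rewrite muln1.
Qed.

Definition cut m (S : pred nat) p q : Prop := forall x y, S x -> ~~ S y ->
  x < nv (diamond m) -> y < nv (diamond m) ->
  dd m x p + dd m p y <= dd m x y \/ dd m x q + dd m q y <= dd m x y.

Lemma cut_separated m B p q : separated m B p q -> cut m (covers m B) p q.
Proof.
by move=> sB x y Bx By _ ym; case: (dd_cut _ _ _ _ _ _ sB Bx ym By) => -[]; auto.
Qed.

Lemma cutC m S p q : cut m S p q -> cut m S q p.
Proof. by move=> cS x y Sx Sy xm ym; case: (cS x y Sx Sy xm ym); auto. Qed.

Lemma cell_cut m k t p q S : cell m k t p q S -> cut m S p q.
Proof.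
case=> <- [i [ik iE ->]]; have := cut_separated _ _ _ _ (separated_block k t i).
by case: iE => -> //= /cutC.
Qed.

Lemma cell_root m : exists S, cell m 0 m 0 1 S /\ forall x, x < nv (diamond m) -> S x.
Proof.
exists (covers m (block m 0)); split; first by split=> //; exists 0; split=> //; left.
move=> x /vertex_dend[j jm jx]; apply/coversP; exists j; split=> //.
by rewrite /block divn_small.
Qed.

Lemma coversU m (B B1 B2 : pred nat) : (forall j, B j = B1 j || B2 j) ->
  covers m B =1 [predU covers m B1 & covers m B2].
Proof.
move=> BE x; rewrite /= /covers -has_predU; apply: eq_has => j /=.
by rewrite BE andb_orl.
Qed.

(* The pairs [S1], [S2] and [S3], [S4] form the two sides of the cell. *)
Lemma cell_split m k t p q S : cell m k t.+1 p q S ->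
  exists a b S1 S2 S3 S4,
  [/\ cell m k.+1 t p a S1, cell m k.+1 t a q S2, cell m k.+1 t p b S3, cell m k.+1 t b q S4 &
   [/\ forall x, S x -> [\/ S1 x, S2 x, S3 x | S4 x],
      cut m [predU S1 & S2] p q & cut m [predU S3 & S4] p q]].
Proof.
(* The opposite orientation follows by exchanging [S1] with [S2] and [S3] with [S4]; each side is
   preserved. *)
wlog : p q S / exists i, [/\ k + t.+1 = m, i < 4 ^ k, de k i = (p, q) & S = covers m (block t.+1 i)].
  move=> wl /[dup] [[ktm [i [ik [iE|iE] SE]]]] cS; first by apply: wl cS; exists i.
  have [||a [b [S1 [S2 [S3 [S4 [c1 c2 c3 c4 [h1 h2 h3]]]]]]]] := wl q p S.
  - by exists i.
  - exact: cellC.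
  exists a, b, S2, S1, S4, S3; split; try exact: cellC.
  have pU (A B : pred nat) : cut m [predU A & B] q p -> cut m [predU B & A] p q.
    by move=> /cutC cAB x y; rewrite /= orbC [B y || _]orbC => /cAB/[apply].
  by split; [move=> x /h1[]; [constructor 2|constructor 1|constructor 4|constructor 3]|exact: pU|exact: pU].
case=> i [ktm ik iE SE] _; rewrite -addSnnS in ktm.
have [e0 e1 e2 e3] := deS _ _ ik; rewrite iE /= in e0 e1 e2 e3.
have [s1 s2] := separated_side _ _ ik; rewrite iE /= in s1 s2.
have c r u v : r < 4 -> de k.+1 (4 * i + r) = (u, v) \/ de k.+1 (4 * i + r) = (v, u) ->
    cell m k.+1 t u v (covers m (block t (4 * i + r))).
  by move=> r4 rE; split=> //; exists (4 * i + r); split=> //; rewrite expnS; lia.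
exists (nv (diamond k) + 2 * i), (nv (diamond k) + 2 * i).+1,
  (covers m (block t (4 * i + 0))), (covers m (block t (4 * i + 1))),
  (covers m (block t (4 * i + 3))), (covers m (block t (4 * i + 2))); split.
- by apply: c => //; rewrite addn0; left.
- by apply: c => //; left.
- by apply: c => //; right.
- by apply: c => //; right.
have side a b : separated k.+1 (fun j => (j == a) || (j == b)) p q ->
    cut m [predU covers m (block t b) & covers m (block t a)] p q.
  move=> sab; have := cut_separated _ _ _ _ (separated_iter _ t _ _ _ sab).
  have BE j : (j %/ 4 ^ t == a) || (j %/ 4 ^ t == b) = block t b j || block t a j.
    by rewrite orbC.
  rewrite ktm => cab x y; rewrite -!(coversU _ _ _ _ BE); exact: cab.
split; last exact: side.
  move=> x; rewrite SE => /coversP[j [jm /eqP ji jx]].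
  rewrite expnS mulnC divnMA in ji.
  have [E|[E|[E|E]]] : j %/ 4 ^ t = 4 * i + 0 \/ j %/ 4 ^ t = 4 * i + 1 \/
     j %/ 4 ^ t = 4 * i + 3 \/ j %/ 4 ^ t = 4 * i + 2 by lia.
  - by constructor 1; apply/coversP; exists j; rewrite /block E.
  - by constructor 2; apply/coversP; exists j; rewrite /block E.
  - by constructor 3; apply/coversP; exists j; rewrite /block E.
  - by constructor 4; apply/coversP; exists j; rewrite /block E.
apply: side => j1 j2 x j1k j2k; rewrite addn0 orbC [X in ~~ X]orbC; exact: s1.
Qed.

(** * Almost geodesic cycles in diamond graphs *)

(* Two almost geodesic discrete paths P and Q from A to B: [NP w] and [NQ w] say
   that the path comes close to [w]; [f_meet] says that P and Q stay apart
   except near A and B. *)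
Record frame m L M R A B (NP NQ : nat -> Prop) : Prop := Frame {
  f_A : A < nv (diamond m);
  f_B : B < nv (diamond m);
  f_far : 2 * L <= dd m A B + M;
  f_P : forall w, w < nv (diamond m) -> NP w -> dd m A w + dd m B w <= 2 * L + 2 * M;
  f_Q : forall w, w < nv (diamond m) -> NQ w -> dd m A w + dd m B w <= 2 * L + 2 * M;
  f_meet : forall w, w < nv (diamond m) -> NP w -> NQ w ->
    dd m A w <= R \/ dd m B w <= R;
  f_cut : forall S p q, p < nv (diamond m) -> q < nv (diamond m) -> cut m S p q ->
    S A != S B -> (NP p \/ NP q) /\ (NQ p \/ NQ q);
  f_M : 0 < M;
  f_MR : M <= R;
  f_RL : 100 * R <= L }.

Lemma frameC m L M R A B NP NQ :
  frame m L M R A B NP NQ -> frame m L M R B A NP NQ.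
Proof.
case=> Am Bm far fP fQ fm fc M0 MR RL; split=> //.
- by rewrite ddC.
- by move=> w wm Nw; rewrite addnC fP.
- by move=> w wm Nw; rewrite addnC fQ.
- by move=> w wm N1 N2; case: (fm w wm N1 N2); auto.
- by move=> S p q pm qm cS; rewrite eq_sym; apply: fc cS.
Qed.

(** The rigidity sought for almost geodesic cycles. When one end is within [4 * R] of a pole, the
    estimates in a [frame] place the other within [6 * R] of an opposite pole, since [M <= R]. *)
Definition anchored m R A B : Prop := exists k t p q S,
  [/\ cell m k t p q S, dd m A p <= 6 * R & dd m B q <= 6 * R].

Lemma anchoredC m R A B : anchored m R A B -> anchored m R B A.
Proof.
by case=> k [t [p [q [S [cS h1 h2]]]]]; exists k, t, q, p, S; split=> //; apply: cellC.
Qed.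

(** Being near [p], the point [A] is outside the quarter [T], so both paths cross its poles [r],
    [q]. A path near [q] puts [q] almost on a geodesic, hence near [B], as [B] is in [S]. Otherwise
    both paths come near [r]; they meet only near their ends and [r] is far from [A], so [B] is near
    [r]. *)
Lemma anchored_far_pole m L M R A B NP NQ k t p q S T r S1 :
  frame m L M R A B NP NQ -> cell m k t.+1 p q S -> S B -> dd m A p <= 4 * R ->
  cell m k.+1 t r q T -> cell m k.+1 t p r S1 -> T B -> anchored m R A B.
Proof.
case=> Am Bm far fP fQ fm fc M0 MR RL cS SB Ap cT c1 TB.
have [_ _ _ pm qm] := cell_bound _ _ _ _ _ _ cS.
have [_ _ _ rm _] := cell_bound _ _ _ _ _ _ cT.
have dS := cell_dist _ _ _ _ _ _ _ cS SB.
have dpq := cell_poles _ _ _ _ _ _ cS.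
have dpr := cell_poles _ _ _ _ _ _ c1.
have drq := cell_poles _ _ _ _ _ _ cT.
rewrite expnS in dS dpq.
have ABp := dd_tri _ _ _ _ Am pm Bm.
have pAq := dd_tri _ _ _ _ pm Am qm.
have pAr := dd_tri _ _ _ _ pm Am rm.
have pA := ddC _ _ _ pm Am; have qB := ddC _ _ _ qm Bm.
have qA := ddC _ _ _ qm Am; have rA := ddC _ _ _ rm Am.
have q_case : dd m A q + dd m B q <= 2 * L + 2 * M -> anchored m R A B.
  move=> Aq; exists k, t.+1, p, q, S; split=> //; lia.
have TA : ~~ T A.
  by apply/negP => /(cell_dist _ _ _ _ _ _ _ cT); lia.
have [|hP hQ] := fc T r q rm qm (cell_cut _ _ _ _ _ _ cT); first by rewrite TB (negPf TA).
case: hP => [Pr|/(fP _ qm)/q_case//]; case: hQ => [Qr|/(fQ _ qm)/q_case//].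
have [|Br] := fm _ rm Pr Qr; first by lia.
by exists k.+1, t, p, r, S1; split=> //; lia.
Qed.

(** Descent with [p] fixed: while [B] is in a quarter touching [p], pass to that quarter; otherwise
    [anchored_far_pole] applies. A single edge is too short to hold [B]. *)
Lemma anchored_pole m L M R A B NP NQ k t p q S :
  frame m L M R A B NP NQ -> cell m k t p q S -> S B -> dd m A p <= 4 * R ->
  anchored m R A B.
Proof.
move=> fr; elim: t k q S => [|t IH] k q S cS SB Ap.
  case: fr => Am Bm far fP fQ fm fc M0 MR RL.
  have [_ _ _ pm qm] := cell_bound _ _ _ _ _ _ cS.
  have := cell_dist _ _ _ _ _ _ _ cS SB; have := dd_tri _ _ _ _ Am pm Bm; lia.
have [a [b [S1 [S2 [S3 [S4 [c1 c2 c3 c4 [cov _ _]]]]]]]] := cell_split _ _ _ _ _ _ cS.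
case: (cov _ SB) => SiB; [exact: IH c1 SiB Ap| |exact: IH c3 SiB Ap|].
  exact: anchored_far_pole fr cS SB Ap c2 c1 SiB.
exact: anchored_far_pole fr cS SB Ap c4 c3 SiB.
Qed.

(** Both paths leave [S1] near [p] or [a]. Passing by [p] is a detour of twice the distance from [A]
    to [p], so [A] is then near [p]. If both use [a], they meet there and [a] is near [A] or [B]. In
    each case one point is near a pole of a cell containing the other. *)
Lemma anchored_series m L M R A B NP NQ k t p a q S S1 S2 :
  frame m L M R A B NP NQ -> cell m k t.+1 p q S -> S A -> S B ->
  cell m k.+1 t p a S1 -> cell m k.+1 t a q S2 -> S1 A -> S2 B -> ~~ S1 B ->
  anchored m R A B.
Proof.
move=> fr cS SA SB c1 c2 SA1 SB2 SB1; have [Am Bm far fP fQ fm fc M0 MR RL] := fr.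
have [_ _ _ pm qm] := cell_bound _ _ _ _ _ _ cS.
have [_ _ _ am _] := cell_bound _ _ _ _ _ _ c2.
have dA := cell_dist _ _ _ _ _ _ _ cS SA; have dB := cell_dist _ _ _ _ _ _ _ cS SB.
have dA1 := cell_dist _ _ _ _ _ _ _ c1 SA1; have dB2 := cell_dist _ _ _ _ _ _ _ c2 SB2.
rewrite expnS in dA dB.
have AaB := dd_tri _ _ _ _ Am am Bm.
have pA := ddC _ _ _ pm Am; have aA := ddC _ _ _ am Am.
have pB := ddC _ _ _ pm Bm; have aB := ddC _ _ _ am Bm.
have p_case : dd m A p + dd m B p <= 2 * L + 2 * M -> anchored m R A B.
  by move=> Ap; apply: (anchored_pole _ _ _ _ _ _ _ _ _ _ _ _ _ fr cS SB); lia.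
have [|hP hQ] := fc S1 p a pm am (cell_cut _ _ _ _ _ _ c1).
  by rewrite SA1 (negPf SB1).
case: hP => [/(fP _ pm)/p_case//|Pa]; case: hQ => [/(fQ _ pm)/p_case//|Qa].
have [Aa|Ba] := fm _ am Pa Qa.
  by apply: (anchored_pole _ _ _ _ _ _ _ _ _ _ _ _ _ fr c2 SB2); lia.
apply/anchoredC.
by apply: (anchored_pole _ _ _ _ _ _ _ _ _ _ _ _ _ (frameC _ _ _ _ _ _ _ _ fr) (cellC _ _ _ _ _ _ c1) SA1); lia.
Qed.

(* Without the handle [E] the cycle could be rotated: its geodesics from [A] to [B]
   may then pass through one pole each, with [A] and [B] away from both poles. *)
Lemma anchored_sides m L M R A B NP NQ k t p q S V E :
  frame m L M R A B NP NQ -> E < nv (diamond m) -> dd m E A <= L ->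
  3 * L <= dd m E B + M ->
  cell m k t p q S -> S A -> S B -> cut m V p q -> V A -> ~~ V B ->
  anchored m R A B.
Proof.
move=> fr Em EA EB cS SA SB cV VA VB; have [Am Bm far fP fQ fm fc M0 MR RL] := fr.
have [_ _ _ pm qm] := cell_bound _ _ _ _ _ _ cS.
have dA := cell_dist _ _ _ _ _ _ _ cS SA; have dB := cell_dist _ _ _ _ _ _ _ cS SB.
have pA := ddC _ _ _ pm Am; have qA := ddC _ _ _ qm Am.
have pB := ddC _ _ _ pm Bm; have qB := ddC _ _ _ qm Bm.
have pE := ddC _ _ _ pm Em; have qE := ddC _ _ _ qm Em.
have EpB := dd_tri _ _ _ _ Em pm Bm; have EqB := dd_tri _ _ _ _ Em qm Bm.
have cS' := cellC _ _ _ _ _ _ cS; have fr' := frameC _ _ _ _ _ _ _ _ fr.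
have pA4 : dd m A p <= 4 * R -> anchored m R A B by exact: anchored_pole fr cS SB.
have qA4 : dd m A q <= 4 * R -> anchored m R A B by exact: anchored_pole fr cS' SB.
have pB4 : dd m B p <= 4 * R -> anchored m R A B.
  by move=> h; apply/anchoredC; exact: anchored_pole fr' cS SA h.
have qB4 : dd m B q <= 4 * R -> anchored m R A B.
  by move=> h; apply/anchoredC; exact: anchored_pole fr' cS' SA h.
(* With both poles almost on geodesics from [A] to [B], the handle end [E] cannot be in [S]:
   averaging the routes through the two poles would bring it too close to [B]. So the way from [A]
   to [E] passes through a pole, which is then near [A]. *)
have mixed : dd m A p + dd m B p <= 2 * L + 2 * M ->
    dd m A q + dd m B q <= 2 * L + 2 * M -> anchored m R A B.
  move=> hp hq; case: (boolP (S E)) => [/(cell_dist _ _ _ _ _ _ _ cS)|SE]; first by lia.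
  have AE := ddC _ _ _ Am Em.
  case: (cell_cut _ _ _ _ _ _ cS _ _ SA SE Am Em) => h; [apply: pA4|apply: qA4]; lia.
have [|hP hQ] := fc V p q pm qm cV; first by rewrite VA (negPf VB).
case: hP hQ => [Pp|Pq] [Qp|Qq].
- by case: (fm _ pm Pp Qp) => h; [apply: pA4|apply: pB4]; lia.
- by apply: mixed; [exact: fP|exact: fQ].
- by apply: mixed; [exact: fQ|exact: fP].
- by case: (fm _ qm Pq Qq) => h; [apply: qA4|apply: qB4]; lia.
Qed.

(** Descent from the whole graph to the smallest subdiamond containing [A] and [B]: there the two
    points lie in successive quarters of one side, or on different sides. *)
Lemma anchored_frame m L M R A B NP NQ E :
  frame m L M R A B NP NQ -> E < nv (diamond m) -> dd m E A <= L ->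
  3 * L <= dd m E B + M -> anchored m R A B.
Proof.
move=> fr Em EA EB; have fr' := frameC _ _ _ _ _ _ _ _ fr.
suff main k t p q S : cell m k t p q S -> S A -> S B -> anchored m R A B.
  by have [S [cS all]] := cell_root m; apply: main cS _ _; apply: all; case: fr.
elim: t k p q S => [|t IH] k p q S cS SA SB.
  case: fr => Am Bm far fP fQ fm fc M0 MR RL.
  have [_ _ _ pm qm] := cell_bound _ _ _ _ _ _ cS.
  have := cell_dist _ _ _ _ _ _ _ cS SB; have := cell_dist _ _ _ _ _ _ _ cS SA.
  have := dd_tri _ _ _ _ Am pm Bm; have := dd_tri _ _ _ _ Am qm Bm.
  have := ddC _ _ _ pm Am; have := ddC _ _ _ qm Am; lia.
have [a [b [S1 [S2 [S3 [S4 [c1 c2 c3 c4 [cov cut1 cut2]]]]]]]] := cell_split _ _ _ _ _ _ cS.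
have same u v T : cell m k.+1 t u v T -> T A -> T B -> anchored m R A B by apply: IH.
have side u T1 T2 : cell m k.+1 t p u T1 -> cell m k.+1 t u q T2 ->
    cut m [predU T1 & T2] p q -> T1 A || T2 A -> anchored m R A B.
  move=> d1 d2 c12 A12.
  case: (boolP (T1 B || T2 B)) => B12; last first.
    exact: anchored_sides fr Em EA EB cS SA SB c12 A12 B12.
  case: (boolP (T1 A)) A12 => /= [A1 _|A1 A2]; case: (boolP (T1 B)) B12 => /= [B1 _|B1 B2].
  - exact: same d1 A1 B1.
  - exact: anchored_series fr cS SA SB d1 d2 A1 B2 B1.
  - apply/anchoredC; exact: anchored_series fr' cS SB SA d1 d2 B1 A2 A1.
  - exact: same d2 A2 B2.
by case: (cov _ SA) => SiA;
  [apply: side c1 c2 cut1 _|apply: side c1 c2 cut1 _|apply: side c3 c4 cut2 _|apply: side c3 c4 cut2 _];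
  rewrite SiA ?orbT.
Qed.

(** * Discrete paths and how they cross cut pairs *)

Definition near_path m M n (P : nat -> nat) w : Prop :=
  exists k, k <= n /\ dd m (P k) w <= M.

Definition steps m M n (P : nat -> nat) : Prop :=
  (forall i, i <= n -> P i < nv (diamond m)) /\
  (forall i, i < n -> dd m (P i) (P i.+1) <= M).

Lemma steps_dist m M n P i j : steps m M n P -> i <= j -> j <= n ->
  dd m (P i) (P j) <= (j - i) * M.
Proof.
case=> Pm Ps /subnKC<-; rewrite addKn; move: (j - i) => k kn.
elim: k kn => [|k IH] kn; first by rewrite addn0 gdistxx // Pm; lia.
have := dd_tri m (P i) (P (i + k)) (P (i + k.+1)); have := IH ltac:(lia).
have := Ps (i + k) ltac:(lia); rewrite -addnS => h1 h2.
move=> /(_ (Pm i ltac:(lia)) (Pm (i + k) ltac:(lia)) (Pm (i + k.+1) ltac:(lia))).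
rewrite mulSn; lia.
Qed.

(** At a step where membership in [S] changes, [cut] puts [p] or [q] between two points at distance
    at most [M]. *)
Lemma steps_crossing m M n P (S : pred nat) p q : steps m M n P ->
  p < nv (diamond m) -> q < nv (diamond m) -> cut m S p q -> S (P 0) != S (P n) ->
  near_path m M n P p \/ near_path m M n P q.
Proof.
move=> [Pm Ps] pm qm cS S0n.
have [k [kn Sk]] : exists k, k < n /\ S (P k) != S (P k.+1).
  elim: n S0n {Pm Ps} => [|n IH]; first by rewrite eqxx.
  case: (eqVneq (S (P 0)) (S (P n))) => [-> h|/IH[k [kn h]] _]; first by exists n.
  by exists k; split=> //; lia.
have P1 := Pm k ltac:(lia); have P2 := Pm k.+1 ltac:(lia); have step := Ps k kn.
have [x [y [Sx Sy xm ym xyE]]] : exists x y, [/\ S x, ~~ S y, x < nv (diamond m),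
    y < nv (diamond m) & (x = P k /\ y = P k.+1) \/ (x = P k.+1 /\ y = P k)].
  case: (boolP (S (P k))) Sk => [Sk|Sk]; case: (boolP (S (P k.+1))) => // Sk1 _.
    by exists (P k), (P k.+1); split=> //; left.
  by exists (P k.+1), (P k); split=> //; right.
have yx := ddC _ _ _ ym xm; have py := ddC _ _ _ pm ym; have qy := ddC _ _ _ qm ym.
by case: (cS x y Sx Sy xm ym) => h; [left|right]; exists k; split; try lia;
   case: xyE => -[? ?]; subst x y; lia.
Qed.

Lemma near_path_dist m M n P w : steps m M n P -> w < nv (diamond m) ->
  near_path m M n P w -> dd m (P 0) w + dd m (P n) w <= n * M + 2 * M.
Proof.
move=> sP wm [k [kn kw]]; have [Pm Ps] := sP.
have h1 := steps_dist _ _ _ _ _ _ sP (leq0n k) kn.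
have h2 := steps_dist _ _ _ _ _ _ sP kn (leqnn n).
have [P0 Pk Pn] : [/\ P 0 < nv (diamond m), P k < nv (diamond m) & P n < nv (diamond m)].
  by split; apply: Pm.
have := dd_tri _ _ _ _ P0 Pk wm; have := dd_tri _ _ _ _ Pn Pk wm.
have := ddC _ _ _ Pn Pk; rewrite subn0 in h1.
have -> : n * M = k * M + (n - k) * M by rewrite -mulnDl subnKC.
lia.
Qed.

(** The delicate field is [f_meet]: if [P k] and [Q l] are near the same [w], then [k] and [l]
    differ by at most 3, or a shortcut would contradict the distance of the ends. Hence [P k] and
    [Q k] are within [5 * M], and their separation forces [k] or [2 * N - k] to be at most [5 * C].
    One more [M] reaches [w], which explains the radius. *)
Lemma frame_paths m C N M P Q : steps m M (2 * N) P -> steps m M (2 * N) Q ->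
  Q 0 = P 0 -> Q (2 * N) = P (2 * N) ->
  2 * (N * M) <= dd m (P 0) (P (2 * N)) + M ->
  (forall i, i <= 2 * N -> M * minn i (2 * N - i) <= C * dd m (P i) (Q i)) ->
  0 < M -> 100 * (5 * C + 1) <= N ->
  frame m (N * M) M ((5 * C + 1) * M) (P 0) (P (2 * N))
    (near_path m M (2 * N) P) (near_path m M (2 * N) Q).
Proof.
move=> sP sQ Q0 Qn far apart M0 NC; have [Pm Ps] := sP; have [Qm Qs] := sQ.
have Am := Pm 0 isT; have Bm := Pm _ (leqnn (2 * N)).
split=> //.
- by move=> w wm /(near_path_dist _ _ _ _ _ sP wm); rewrite mulnA.
- by move=> w wm /(near_path_dist _ _ _ _ _ sQ wm); rewrite mulnA Q0 Qn.
- move=> w wm [k [kn kw]] [l [ln lw]].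
  have Pk := Pm _ kn; have Ql := Qm _ ln; have Qk := Qm _ kn.
  have P0k := steps_dist _ _ _ _ _ _ sP (leq0n k) kn.
  have Pkn := steps_dist _ _ _ _ _ _ sP kn (leqnn _).
  have Q0l := steps_dist _ _ _ _ _ _ sQ (leq0n l) ln.
  have Qln := steps_dist _ _ _ _ _ _ sQ ln (leqnn _).
  rewrite subn0 in P0k Q0l; rewrite Q0 in Q0l; rewrite Qn in Qln.
  have t1 := dd_tri _ _ _ _ Pk wm Ql; have wQ := ddC _ _ _ wm Ql.
  have t2 := dd_tri _ _ _ _ Am Pk Bm; have t3 := dd_tri _ _ _ _ Am Ql Bm.
  have t4 := dd_tri _ _ _ _ Am Pk Ql; have t5 := dd_tri _ _ _ _ Pk Ql Bm.
  have t6 := dd_tri _ _ _ _ Am Pk wm; have t7 := dd_tri _ _ _ _ Bm Pk wm.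
  have t8 := dd_tri _ _ _ _ Am Ql Pk; have t9 := dd_tri _ _ _ _ Ql Pk Bm.
  have PQ := ddC _ _ _ Pk Ql; have BP := ddC _ _ _ Bm Pk.
  have kl : k <= l + 3.
    rewrite leqNgt; apply/negP => lk.
    have : (2 * N - k + l + 4) * M <= 2 * N * M by rewrite leq_mul2r; apply/orP; right; lia.
    rewrite !mulnDl; lia.
  have lk : l <= k + 3.
    rewrite leqNgt; apply/negP => kl'.
    have : (2 * N - l + k + 4) * M <= 2 * N * M by rewrite leq_mul2r; apply/orP; right; lia.
    rewrite !mulnDl; lia.
  have t10 := dd_tri _ _ _ _ Pk Ql Qk.
  have Qlk : dd m (Q l) (Q k) <= 3 * M.
    have [kl'|kl'] := leqP k l.
      rewrite ddC //; apply: leq_trans (steps_dist _ _ _ _ _ _ sQ kl' ln) _.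
      by rewrite leq_mul2r; apply/orP; right; lia.
    apply: leq_trans (steps_dist _ _ _ _ _ _ sQ (ltnW kl') kn) _.
    by rewrite leq_mul2r; apply/orP; right; lia.
  have : M * minn k (2 * N - k) <= M * (5 * C).
    have dk : dd m (P k) (Q k) <= 5 * M by lia.
    by apply: leq_trans (apart k kn) _; rewrite mulnA [M * 5]mulnC [leqRHS]mulnC leq_mul2l dk orbT.
  rewrite leq_pmul2l // geq_min => /orP[hk|hk]; [left|right].
    have : k * M <= 5 * C * M by rewrite leq_mul2r hk orbT.
    rewrite mulnDl; lia.
  have : (2 * N - k) * M <= 5 * C * M by rewrite leq_mul2r hk orbT.
  rewrite mulnDl; lia.
- move=> S p q pm qm cS S0n; split; first exact: steps_crossing cS S0n.
  by apply: steps_crossing sQ pm qm cS _; rewrite Q0 Qn.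
- by rewrite mulnDl mul1n leq_addl.
- by rewrite mulnA leq_mul2r NC orbT.
Qed.

(* The poles near [A] and [B] belong to a level at most that of the poles near
   [A'] and [B'], so the poles near [A] and [A'] are at distance a multiple of
   about [2 * L], whereas [A] and [A'] are at distance about [L]. *)
Lemma anchored_gap m M R L A B A' B' : anchored m R A B -> anchored m R A' B' ->
  A < nv (diamond m) -> B < nv (diamond m) -> A' < nv (diamond m) -> B' < nv (diamond m) ->
  8 * L <= dd m A B + M -> dd m A B <= 8 * L ->
  2 * L <= dd m A' B' + M -> dd m A' B' <= 2 * L ->
  L <= dd m A A' + M -> dd m A A' <= L -> M <= R -> 100 * R <= L -> 0 < R -> False.
Proof.
move=> [k [t [p [q [S [cS Ap Bq]]]]]] [k' [t' [p' [q' [S' [cS' Ap' Bq']]]]]].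
move=> Am Bm Am' Bm' AB1 AB2 AB1' AB2' AA1 AA2 MR RL R0.
have [km pk qk pm qm] := cell_bound _ _ _ _ _ _ cS.
have [km' pk' qk' pm' qm'] := cell_bound _ _ _ _ _ _ cS'.
have dpq := cell_poles _ _ _ _ _ _ cS; have dpq' := cell_poles _ _ _ _ _ _ cS'.
have s1 := ddC _ _ _ Am pm; have s2 := ddC _ _ _ Bm qm.
have s3 := ddC _ _ _ Am' pm'; have s4 := ddC _ _ _ Bm' qm'.
have t1 := dd_tri _ _ _ _ Am pm Bm; have t2 := dd_tri _ _ _ _ pm qm Bm.
have t3 := dd_tri _ _ _ _ Am' pm' Bm'; have t4 := dd_tri _ _ _ _ pm' qm' Bm'.
have u1 := dd_tri _ _ _ _ pm Am qm; have u2 := dd_tri _ _ _ _ Am Bm qm.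
have u3 := dd_tri _ _ _ _ pm' Am' qm'; have u4 := dd_tri _ _ _ _ Am' Bm' qm'.
have kk : k <= k'.
  have : 2 ^ t' <= 2 ^ t by lia.
  rewrite leq_exp2l //; case: cS cS' => [e1 _] [e2 _]; lia.
have pk2 : p < nv (diamond k').
  by rewrite -(subnKC kk); apply: leq_trans pk (nv_diamond_le _ _).
have dpp : dd m p p' = 2 ^ t' * dd k' p p'.
  by case: cS' => <- _; rewrite dd_scale.
have v1 := dd_tri _ _ _ _ pm Am pm'; have v2 := dd_tri _ _ _ _ Am Am' pm'.
have v3 := dd_tri _ _ _ _ Am pm Am'; have v4 := dd_tri _ _ _ _ pm pm' Am'.
(* As [2 ^ t'] is about [2 * L], the multiple 0 puts [A] and [A'] too close together and any
   positive multiple puts them too far apart. *)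
case: (dd k' p p') dpp => [|z]; first by rewrite muln0; lia.
rewrite mulnS; lia.
Qed.

(** * Laakso graphs *)

Definition laakso_piece (N j : nat) (e : nat * nat) : seq (nat * nat) :=
  let b := N + 4 * j in
  [:: (e.1, b); (b, b + 1); (b, b + 2); (b + 1, b + 3); (b + 2, b + 3); (b + 3, e.2)].

Lemma mem_laakso_edges N i s e : e \in laakso_edges N i s <->
  exists j, j < size s /\ e \in laakso_piece N (i + j) (nth (0, 0) s j).
Proof.
elim: s i => [|[u v] s IH] i; first by split=> // -[j []].
rewrite -[laakso_edges _ _ _]/(_ ++ _) mem_cat; split.
  case/orP => [h|/IH[j [js h]]]; first by exists 0; split=> //; rewrite addn0.
  by exists j.+1; rewrite addnS -addSn.
case=> -[|j] [js] /=.
  by rewrite addn0 => h; apply/orP; left.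
by rewrite addnS -addSn => h; apply/orP; right; apply/IH; exists j.
Qed.

Lemma mem_laakso_step G e : e \in es (laakso_step G) <->
  exists j, j < size (es G) /\ e \in laakso_piece (nv G) j (nth (0, 0) (es G) j).
Proof. exact: mem_laakso_edges. Qed.

Lemma wf_laakso_step G : wfg G -> wfg (laakso_step G).
Proof.
move=> wG u v /mem_laakso_step[j [js]]; have := mem_nth (0, 0) js.
case: (nth _ _ j) => a b /wG[aG bG]; rewrite !inE /= !xpair_eqE.
by case/or4P => [|||/or3P[||]] /andP[/eqP-> /eqP->]; lia.
Qed.

Lemma laakso_piece_mem G j : j < size (es G) ->
  {subset laakso_piece (nv G) j (nth (0, 0) (es G) j) <= es (laakso_step G)}.
Proof. by move=> js e ej; apply/mem_laakso_step; exists j. Qed.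

Lemma conn_laakso_step G : wfg G -> connected G -> connected (laakso_step G).
Proof.
move=> wG cG x xG.
have piece j : j < size (es G) -> let b := nv G + 4 * j in
    let: (u, v) := nth (0, 0) (es G) j in
    [/\ adj (laakso_step G) u b, adj (laakso_step G) b (b + 1), adj (laakso_step G) b (b + 2),
        adj (laakso_step G) (b + 1) (b + 3) & adj (laakso_step G) (b + 3) v].
  move=> /laakso_piece_mem + b; rewrite /laakso_piece /= -/b; case: (nth _ _ j) => u v sub.
  by split; rewrite /adj; apply/orP; left; apply: sub; rewrite !inE eqxx ?orbT.
have old y : y < nv G -> reach (laakso_step G) y.
  move=> /cG; apply: reach_refine => u v /orP[] /(nthP (0, 0))[j /piece + jE];
  rewrite jE => -[h1 h2 _ h3 h4] ru.
    exact: reach_adj _ _ _ (reach_adj _ _ _ (reach_adj _ _ _ (reach_adj _ _ _ ru h1) h2) h3) h4.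
  rewrite adjC in h1; rewrite adjC in h2; rewrite adjC in h3; rewrite adjC in h4.
  exact: reach_adj _ _ _ (reach_adj _ _ _ (reach_adj _ _ _ (reach_adj _ _ _ ru h4) h3) h2) h1.
have [/old//|xG'] := ltnP x (nv G); rewrite /= in xG.
pose j := (x - nv G) %/ 4; have js : j < size (es G) by lia.
have := piece _ js; have := mem_nth (0, 0) js; case: (nth _ _ j) => u v /wG[uG _] [h1 h2 h3 h4 _].
have r0 := reach_adj _ _ _ (old _ uG) h1; have r1 := reach_adj _ _ _ r0 h2.
have r2 := reach_adj _ _ _ r0 h3; have r3 := reach_adj _ _ _ r1 h4.
have [->|[->|[->|->]]] : x = nv G + 4 * j \/ x = nv G + 4 * j + 1 \/
  x = nv G + 4 * j + 2 \/ x = nv G + 4 * j + 3 by lia.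
all: by [].
Qed.

(* Linear interpolation along the subdivided edges, scaled by 4. *)
Definition laakso_ext (G : graph) (g : nat -> nat) (x : nat) : nat :=
  if x < nv G then 4 * g x
  else let: (u, v) := nth (0, 0) (es G) ((x - nv G) %/ 4) in
    match (x - nv G) %% 4 with
    | 0 => 3 * g u + g v
    | 1 | 2 => 2 * g u + 2 * g v
    | _ => g u + 3 * g v
    end.

Lemma laakso_extE G g j (b := nv G + 4 * j) (u := (nth (0, 0) (es G) j).1)
    (v := (nth (0, 0) (es G) j).2) :
  [/\ laakso_ext G g b = 3 * g u + g v, laakso_ext G g (b + 1) = 2 * g u + 2 * g v,
      laakso_ext G g (b + 2) = 2 * g u + 2 * g v &
      laakso_ext G g (b + 3) = g u + 3 * g v].
Proof.
have E r : r < 4 -> (b + r < nv G) = false /\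
    (b + r - nv G) %/ 4 = j /\ (b + r - nv G) %% 4 = r by rewrite /b; lia.
have E0 := E 0 isT; rewrite addn0 in E0.
have [] := (E0, E 1 isT, E 2 isT, E 3 isT) => -[[[b0 [d0 m0]] [b1 [d1 m1]]] [b2 [d2 m2]]] [b3 [d3 m3]].
rewrite /laakso_ext b0 b1 b2 b3 d0 d1 d2 d3 m0 m1 m2 m3 {}/u {}/v.
by case: (nth _ _ j).
Qed.

Lemma lip_laakso_ext G g : wfg G -> lip G g -> lip (laakso_step G) (laakso_ext G g).
Proof.
move=> wG lG x y /mem_laakso_step[j [js]]; have [e0 e1 e2 e3] := laakso_extE G g j.
move: (mem_nth (0, 0) js) e0 e1 e2 e3; case: (nth _ _ j) => u v uv /=.
set b := nv G + 4 * j => e0 e1 e2 e3; have := lG _ _ uv; have [uG vG] := wG _ _ uv.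
have eu : laakso_ext G g u = 4 * g u by rewrite /laakso_ext uG.
have ev : laakso_ext G g v = 4 * g v by rewrite /laakso_ext vG.
rewrite !inE !xpair_eqE => guv.
by case/or4P => [|||/or3P[||]] /andP[/eqP-> /eqP->]; rewrite -?/b /= ?eu ?ev ?e0 ?e1 ?e2 ?e3; lia.
Qed.


(** * Iterated subdivision and the copies of [L_1] *)

Lemma wf_refine j G : wfg G -> wfg (refine j G).
Proof. by move=> wG; elim: j => //= j; apply: wf_laakso_step. Qed.

Lemma conn_refine j G : wfg G -> connected G -> connected (refine j G).
Proof.
by move=> wG cG; elim: j => //= j; apply: conn_laakso_step; apply: wf_refine.
Qed.

Lemma nv_refine j G : nv G <= nv (refine j G).
Proof. by elim: j => //= j IH; apply: leq_trans IH _; apply: leq_addr. Qed.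

Fixpoint refine_ext G g j : nat -> nat :=
  if j is j'.+1 then laakso_ext (refine j' G) (refine_ext G g j') else g.

Lemma lip_refine_ext G g j : wfg G -> lip G g -> lip (refine j G) (refine_ext G g j).
Proof.
by move=> wG lG; elim: j => //= j; apply: lip_laakso_ext; apply: wf_refine.
Qed.

Lemma refine_ext_old G g j x : x < nv G -> refine_ext G g j x = 4 ^ j * g x.
Proof.
move=> xG; elim: j => [|j IH] /=; first by rewrite mul1n.
by rewrite /laakso_ext (leq_trans xG (nv_refine j G)) IH expnS mulnA.
Qed.

(** [w] follows one branch through every subdivided edge, on which each extended function
    interpolates linearly; the products on both sides avoid subtraction in [nat]. *)
Lemma refine_path G u v j : (u, v) \in es G -> exists w : nat -> nat,
  [/\ w 0 = u, w (4 ^ j) = v,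
      forall i, i < 4 ^ j -> (w i, w i.+1) \in es (refine j G) &
      forall g i, wfg G -> i <= 4 ^ j ->
        refine_ext G g j (w i) + i * g u = 4 ^ j * g u + i * g v].
Proof.
move=> uv; elim: j => [|j [w [w0 wn wE wg]]].
  exists (fun i => if i is 0 then u else v); rewrite expn0; split=> //.
    by case.
  by move=> g [|[|i]] //= _ _; lia.
set H := refine j G in wE wg.
pose b q := nv H + 4 * index (w q, w q.+1) (es H).
have [w' w'0 [w'1 w'2 w'3]] : exists2 w' : nat -> nat, forall q, w' (4 * q) = w q &
    [/\ forall q, w' (4 * q + 1) = b q, forall q, w' (4 * q + 2) = b q + 1 &
        forall q, w' (4 * q + 3) = b q + 3].
  exists (fun i => match i %% 4 with 0 => w (i %/ 4) | 1 => b (i %/ 4)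
    | 2 => b (i %/ 4) + 1 | _ => b (i %/ 4) + 3 end).
    by move=> q; rewrite modnMr mulKn.
  have E q r : r < 4 -> (4 * q + r) %% 4 = r /\ (4 * q + r) %/ 4 = q by lia.
  split=> q; [have [] := E q 1 isT|have [] := E q 2 isT|have [] := E q 3 isT];
  by move=> -> ->.
have C i : [\/ i = 4 * (i %/ 4), i = 4 * (i %/ 4) + 1, i = 4 * (i %/ 4) + 2
    | i = 4 * (i %/ 4) + 3].
  have : i = 4 * (i %/ 4) \/ i = 4 * (i %/ 4) + 1 \/ i = 4 * (i %/ 4) + 2
    \/ i = 4 * (i %/ 4) + 3 by lia.
  by case=> [|[|[|]]]; [constructor 1|constructor 2|constructor 3|constructor 4].
exists w'; rewrite expnS; split.
- by rewrite -w0 -(w'0 0).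
- by rewrite w'0.
- move=> i il; have := C i; set q := i %/ 4; have ql : q < 4 ^ j by rewrite /q; lia.
  have := laakso_piece_mem H (index (w q, w q.+1) (es H)).
  rewrite index_mem nth_index ?wE // -/(b q) => /(_ isT); rewrite /laakso_piece /= -/(b q) => sub iE.
  have w4 : w' (4 * q + 4) = w q.+1 by rewrite -w'0 mulnS addnC.
  suff [s0 s1 s2 s3] : [/\ (w' (4 * q), w' (4 * q + 1)) \in es (laakso_step H),
      (w' (4 * q + 1), w' (4 * q + 2)) \in es (laakso_step H),
      (w' (4 * q + 2), w' (4 * q + 3)) \in es (laakso_step H) &
      (w' (4 * q + 3), w' (4 * q + 4)) \in es (laakso_step H)].
    by case: iE => ->; rewrite -?[(4 * q + _).+1]addnS -?[(4 * q).+1]addn1.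
  by rewrite w4 w'0 w'1 w'2 w'3; split; apply: sub; rewrite !inE eqxx ?orbT.
- move=> g i wG il; have := C i; set q := i %/ 4 => iE.
  (* The last vertex is treated apart, as no edge of the path starts there. *)
  have [->|iN] := eqVneq i (4 * 4 ^ j).
    rewrite w'0 /= /laakso_ext wn -/H (leq_trans (wG _ _ uv).2 (nv_refine j G)).
    by have := wg g _ wG (leqnn _); rewrite wn -/H; lia.
  have ql : q < 4 ^ j by rewrite /q; lia.
  have := wg g q wG (ltnW ql); have := wg g q.+1 wG ql; rewrite -/H.
  have := laakso_extE H (refine_ext G g j) (index (w q, w q.+1) (es H)).
  rewrite nth_index ?wE // -/(b _) [refine_ext _ _ j.+1]/= -/H => -[e0 e1 e2 e3].
  have e : laakso_ext H (refine_ext G g j) (w q) = 4 * refine_ext G g j (w q).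
    by have [wH _] := wf_refine j G wG _ _ (wE _ ql); rewrite /laakso_ext wH.
  move: e e0 e1 e2 e3; rewrite /=.
  move: (refine_ext G g j (w q)) (refine_ext G g j (w q.+1)) => a a' e e0 e1 e2 e3.
  move: (g u) (g v) (4 ^ j) => c d N.
  rewrite !mulSn => g1 g0.
  by case: iE => ->; rewrite ?w'0 ?w'1 ?w'2 ?w'3 ?e ?e0 ?e1 ?e2 ?e3 !(mulnDl, mulnA); lia.
Qed.

Lemma lip_indicator G c : lip G (fun x => x == c).
Proof. by move=> u v _; case: (u == c); case: (v == c). Qed.

(** The extended indicator of [x] is [4 ^ h] at [x] and 0 at [y]. *)
Lemma refine_gdist_ge G h x y : wfg G -> connected G -> x < nv G -> y < nv G ->
  x != y -> 4 ^ h <= gdist (refine h G) x y.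
Proof.
move=> wG cG xG yG xy; have lg := lip_refine_ext _ _ h wG (lip_indicator G x).
have le z : z < nv G -> z < nv (refine h G) by move=> /leq_trans; apply; apply: nv_refine.
have := gdist_lip _ _ x y (wf_refine h G wG) (conn_refine h G wG cG) lg (le _ xG) (le _ yG).
by rewrite !refine_ext_old // eqxx eq_sym (negPf xy) muln0 muln1.
Qed.

Lemma refine_gdist_le G h u v : wfg G -> connected G -> (u, v) \in es G ->
  gdist (refine h G) u v <= 4 ^ h.
Proof.
move=> wG cG uv; have [w [<- <- wE _]] := refine_path _ _ _ h uv.
have wH := wf_refine h G wG; have cH := conn_refine h G wG cG.
suff H i : i <= 4 ^ h -> gdist (refine h G) (w 0) (w i) <= i by apply: H.
elim: i => [_|i IH il].
  by have := wE 0; rewrite expn_gt0 => /(_ isT)/wH[b _]; rewrite gdistxx.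
have [b0 _] := wH _ _ (wE 0 (leq_ltn_trans (leq0n i) il)).
have [bi bi1] := wH _ _ (wE i il).
have := gdist_tri _ _ _ _ wH cH b0 bi bi1; have := IH (ltnW il).
have : gdist (refine h G) (w i) (w i.+1) <= 1.
  by apply: adj_gdist => //; rewrite /adj wE.
lia.
Qed.

Lemma refine_path2 G u z v j (N := 4 ^ j) : (u, z) \in es G -> (z, v) \in es G ->
  exists w : nat -> nat,
  [/\ w 0 = u, w (2 * N) = v,
      forall i, i < 2 * N -> (w i, w i.+1) \in es (refine j G),
      forall g i, wfg G -> i <= N ->
        refine_ext G g j (w i) + i * g u = N * g u + i * g z &
      forall g i, wfg G -> i <= N ->
        refine_ext G g j (w (N + i)) + i * g z = N * g z + i * g v].
Proof.
move=> /(refine_path _ _ _ j)[w [w0 wN wE wg]] /(refine_path _ _ _ j)[w' [w0' wN' wE' wg']].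
have N0 : 0 < N by rewrite expn_gt0.
exists (fun i => if i < N then w i else w' (i - N)); split.
- by rewrite N0.
- by rewrite -wN' mul2n -addnn ltnNge leq_addr addnK.
- move=> i il; case: ltnP => h; case: ltnP => h'.
  + exact: wE.
  + have -> : i.+1 - N = 0 by lia.
    by rewrite w0' -wN -/N (_ : N = i.+1) ?wE //; lia.
  + lia.
  + by rewrite subSn //; apply: wE'; lia.
- move=> g i wG iN; case: ltnP => h; first exact: wg.
  have -> : i = N by lia.
  by rewrite subnn w0'; have := wg g N wG (leqnn _); rewrite wN.
- by move=> g i wG iN; rewrite ltnNge leq_addr addKn; apply: wg'.
Qed.

(** [P] and [Q] subdivide the two sides of the 4-cycle. The extended indicator of [x3] is a tent
    function along [P] and vanishes along [Q]; being 1-Lipschitz, it keeps them apart. *)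
Lemma laakso_copy G u v j h (N := 4 ^ j) : wfg G -> connected G -> (u, v) \in es G ->
  exists x2 x3 x5 (P Q : nat -> nat),
  [/\ [/\ (u, x2) \in es (laakso_step G), (x2, x3) \in es (laakso_step G),
          (x3, x5) \in es (laakso_step G) & (x5, v) \in es (laakso_step G)],
      [/\ P 0 = x2, Q 0 = x2, P (2 * N) = x5 & Q (2 * N) = x5],
      forall i, i < 2 * N -> (P i, P i.+1) \in es (refine j (laakso_step G)),
      forall i, i < 2 * N -> (Q i, Q i.+1) \in es (refine j (laakso_step G)) &
      forall i, i <= 2 * N -> 4 ^ h * minn i (2 * N - i) <=
        gdist (refine h (refine j (laakso_step G))) (P i) (Q i)].
Proof.
move=> wG cG /(nthP (0, 0))[l ls lE]; have := laakso_piece_mem G l ls.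
rewrite lE /laakso_piece /=; set b := nv G + 4 * l => sub.
have w1 := wf_laakso_step G wG; have c1 := conn_laakso_step G wG cG.
have [e1 e2 e3] : [/\ (u, b) \in es (laakso_step G), (b, b + 1) \in es (laakso_step G) &
   (b, b + 2) \in es (laakso_step G)].
  by split; apply: sub; rewrite !inE eqxx ?orbT.
have [e4 e5 e6] : [/\ (b + 1, b + 3) \in es (laakso_step G), (b + 2, b + 3) \in es (laakso_step G) &
   (b + 3, v) \in es (laakso_step G)].
  by split; apply: sub; rewrite !inE eqxx ?orbT.
have [P [P0 Pn PE Pg Pg']] := refine_path2 _ _ _ _ j e2 e4.
have [Q [Q0 Qn QE Qg Qg']] := refine_path2 _ _ _ _ j e3 e5.
exists b, (b + 1), (b + 3), P, Q; split=> // i il.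
have N0 : 0 < N by rewrite expn_gt0.
set g := fun x => nat_of_bool (x == b + 1).
have [g1 g2 g3 g0] : [/\ g (b + 1) = 1, g (b + 2) = 0, g (b + 3) = 0 & g b = 0].
  by rewrite /g eqxx; split=> //; lia.
set H := refine j _; have wH := wf_refine j _ w1; have cH := conn_refine j _ w1 c1.
have lH : lip H (refine_ext (laakso_step G) g j).
  by apply: lip_refine_ext => //; apply: lip_indicator.
have [gP gQ] : refine_ext (laakso_step G) g j (P i) = minn i (2 * N - i) /\
    refine_ext (laakso_step G) g j (Q i) = 0.
  have [iN|iN] := leqP i N.
    have := Pg g i w1 iN; have := Qg g i w1 iN; rewrite g0 g1 g2 -/N.
    by rewrite !muln0 !addn0 muln1 => -> ->; split=> //; lia.
  have iN1 : i - N <= N by lia.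
  have iN2 : N + (i - N) = i by lia.
  have := Pg' g _ w1 iN1; have := Qg' g _ w1 iN1; rewrite -/N iN2 g1 g2 g3.
  by rewrite !muln0 !addn0 !muln1 => -> h1; split=> //; lia.
have bd (w : nat -> nat) : (forall i, i < 2 * N -> (w i, w i.+1) \in es H) -> w i < nv H.
  move=> wE; case: i il {gP gQ} => [_|i il]; last by case: (wH _ _ (wE i il)).
  by case: (wH _ _ (wE 0 _)) => //; rewrite muln_gt0 N0.
have PH := bd _ PE; have QH := bd _ QE.
have lh := lip_refine_ext _ _ h wH lH.
have le z : z < nv H -> z < nv (refine h H) by move=> /leq_trans; apply; apply: nv_refine.
have := gdist_lip _ _ (P i) (Q i) (wf_refine h H wH) (conn_refine h H wH cH) lh (le _ PH) (le _ QH).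
by rewrite !(refine_ext_old H) // gP gQ muln0.
Qed.

(** Distances are measured [h] levels below the edges of [refine j G], where such an edge has length
    at most [4 ^ h]. [M] bounds the stretch of these edges, and the last clause is a lower
    bilipschitz bound relative to the same [M]. *)
Definition stretch m C M F G j h : Prop :=
  [/\ forall x, x < nv (refine h (refine j G)) -> F x < nv (diamond m),
      forall a b, (a, b) \in es (refine j G) -> dd m (F a) (F b) <= M &
      forall x y, x < nv (refine h (refine j G)) -> y < nv (refine h (refine j G)) ->
        M * gdist (refine h (refine j G)) x y <= C * 4 ^ h * dd m (F x) (F y)].

Lemma stretch_steps m C M F G j h n (w : nat -> nat) : wfg G -> 0 < n ->
  stretch m C M F G j h -> (forall i, i < n -> (w i, w i.+1) \in es (refine j G)) ->
  steps m M n (fun i => F (w i)).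
Proof.
move=> wG n0 [Fm FM _] wE; split=> [i il|i il]; last by apply/FM/wE.
apply: Fm; apply: leq_trans (nv_refine h _).
case: i il => [_|i il].
  by have [] := wf_refine j G wG _ _ (wE _ n0).
by have [] := wf_refine j G wG _ _ (wE _ il).
Qed.

Lemma stretch_edge m C M F G j h u v : wfg G -> stretch m C M F G j h ->
  (u, v) \in es G ->
  [/\ F u < nv (diamond m), F v < nv (diamond m) & dd m (F u) (F v) <= 4 ^ j * M].
Proof.
move=> wG sF uv; have [w [w0 wn wE _]] := refine_path _ _ _ j uv.
have n0 : 0 < 4 ^ j by rewrite expn_gt0.
have sw := stretch_steps _ _ _ _ _ _ _ _ _ wG n0 sF wE.
have := steps_dist _ _ _ _ _ _ sw (leq0n _) (leqnn _); case: sw => sm _.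
have := sm 0 isT; have := sm _ (leqnn _); rewrite w0 wn subn0.
by split.
Qed.

(** The four edges of the way from [u] to [v] through [x2], [x3], [x5] are each stretched to at most
    [N * M]. Together they span almost [4 * (N * M)], so the distances between these points are
    exact up to [M]. This makes the cycle a [frame], with [F u] as the end of the handle. *)
Lemma copy_anchored m C M F G j h u v (N := 4 ^ j) (R := (5 * C + 1) * M) :
  wfg G -> connected G -> stretch m C M F (laakso_step G) j h -> (u, v) \in es G ->
  0 < M -> 100 * (5 * C + 1) <= N -> 4 * (N * M) <= dd m (F u) (F v) + M ->
  exists x2 x3 x5, [/\ (x2, x3) \in es (laakso_step G),
    [/\ F x2 < nv (diamond m), F x5 < nv (diamond m) & anchored m R (F x2) (F x5)],
    N * M <= dd m (F x2) (F x3) + M,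
    N * M <= dd m (F u) (F x2) + M /\ dd m (F u) (F x2) <= N * M &
    2 * (N * M) <= dd m (F x2) (F x5) + M /\ dd m (F x2) (F x5) <= 2 * (N * M)].
Proof.
move=> wG cG sF uv M0 NC far.
have [x2 [x3 [x5 [P [Q [[e1 e2 e3 e4] [P0 Q0 Pn Qn] PE QE apart]]]]]] :=
  laakso_copy G u v j h wG cG uv.
have w1 := wf_laakso_step G wG.
have [um x2m d1] := stretch_edge _ _ _ _ _ _ _ _ _ w1 sF e1.
have [_ x3m d2] := stretch_edge _ _ _ _ _ _ _ _ _ w1 sF e2.
have [_ x5m d3] := stretch_edge _ _ _ _ _ _ _ _ _ w1 sF e3.
have [_ vm d4] := stretch_edge _ _ _ _ _ _ _ _ _ w1 sF e4.
rewrite -/N in PE QE apart d1 d2 d3 d4 Pn Qn.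
have t1 := dd_tri _ _ _ _ um x2m vm; have t2 := dd_tri _ _ _ _ x2m x3m vm.
have t3 := dd_tri _ _ _ _ x3m x5m vm; have t4 := dd_tri _ _ _ _ um x5m vm.
have t5 := dd_tri _ _ _ _ x2m x5m vm; have t6 := dd_tri _ _ _ _ x2m x3m x5m.
have n0 : 0 < 2 * N by rewrite muln_gt0 expn_gt0.
have sP := stretch_steps _ _ _ _ _ _ _ _ _ w1 n0 sF PE.
have sQ := stretch_steps _ _ _ _ _ _ _ _ _ w1 n0 sF QE.
exists x2, x3, x5; split=> //; try (by lia); try (by split; lia).
have fr : frame m (N * M) M R (F x2) (F x5) (near_path m M (2 * N) (fun i => F (P i)))
    (near_path m M (2 * N) (fun i => F (Q i))).
  rewrite -P0 -Pn; apply: (frame_paths m C N M _ _ sP sQ) => //.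
  - by rewrite P0 Q0.
  - by rewrite Pn Qn.
  - by rewrite P0 Pn; lia.
  move=> i il; have [_ _ F3] := sF.
  have h0 : 0 < 4 ^ h by rewrite expn_gt0.
  have wH := wf_refine j _ w1.
  have bd (w : nat -> nat) : (forall i, i < 2 * N -> (w i, w i.+1) \in
      es (refine j (laakso_step G))) -> w i < nv (refine h (refine j (laakso_step G))).
    move=> wE; apply: leq_trans (nv_refine h _).
    case: i il => [_|i il]; last by case: (wH _ _ (wE i il)).
    by case: (wH _ _ (wE 0 n0)).
  have := F3 _ _ (bd _ PE) (bd _ QE); have := apart i il.
  rewrite -(leq_pmul2l M0) => a1 a2; rewrite -(leq_pmul2l h0) mulnCA [leqRHS]mulnA [4 ^ h * C]mulnC.
  exact: leq_trans a1 a2.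
split=> //; apply: anchored_frame fr um d1 _; lia.
Qed.

(** The edge from [u] to [v] gives a first anchored cycle. Its edge from [x2] to [x3] is almost
    fully stretched too, and gives a second one at a quarter of the scale; [anchored_gap] with
    [4 ^ j * M] for [L] excludes the pair. *)
Lemma not_stretched m C M F G j h u v : wfg G -> connected G ->
  stretch m C M F G j.+2 h -> (u, v) \in es G -> 0 < M ->
  100 * (5 * C + 1) <= 4 ^ j -> 4 ^ j.+2 * M <= dd m (F u) (F v) + M -> False.
Proof.
move=> wG cG sF uv M0 jC far.
have w1 := wf_laakso_step G wG; have c1 := conn_laakso_step G wG cG.
have sF1 : stretch m C M F (laakso_step G) j.+1 h by move: sF; rewrite /stretch iterSr.
have sF2 : stretch m C M F (laakso_step (laakso_step G)) j h.
  by move: sF1; rewrite /stretch iterSr.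
have [||x2 [x3 [x5 [e [Am Bm AB] x23 _ [d1 d2]]]]] :=
  copy_anchored _ _ _ _ _ _ _ _ _ wG cG sF1 uv M0.
- by rewrite expnS; lia.
- by move: far; rewrite expnS -mulnA.
have [||y2 [y3 [y5 [_ [Am' Bm' AB'] _ [d3 d4] [d5 d6]]]]] :=
  copy_anchored _ _ _ _ _ _ _ _ _ w1 c1 sF2 e M0.
- exact: jC.
- by move: x23; rewrite expnS -mulnA.
apply: (anchored_gap m M _ (4 ^ j * M) _ _ _ _ AB AB') => //.
- by move: d1; rewrite expnS; lia.
- by move: d2; rewrite expnS; lia.
- by rewrite mulnDl mul1n leq_addl.
- by rewrite mulnA leq_mul2r jC orbT.
- by rewrite muln_gt0 M0 andbT addn1.
Qed.

(** * Coarse differentiation *)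

Lemma bigmax_attained (T : eqType) (s : seq T) (phi : T -> nat) :
  0 < \max_(e <- s) phi e -> exists2 e, e \in s & \max_(e <- s) phi e = phi e.
Proof.
elim: s => [|a s IH]; first by rewrite big_nil.
rewrite big_cons; set M := \max_(e <- s) phi e in IH *.
case: (leqP M (phi a)) => [Ma _|aM M0]; first by exists a; rewrite ?mem_head.
by have [|e es ->] := IH; [lia|exists e; rewrite // inE es orbT].
Qed.

(** Bernoulli's inequality for [(1 + 1 / q) ^ s], multiplied by [q ^ (s + 1)]. *)
Lemma exp_succ_lower q s : (q + s) * q ^ s <= q * (q + 1) ^ s.
Proof.
elim: s => [|s IH]; first by rewrite addn0 !muln1.
rewrite !expnS; move: (q ^ s) ((q + 1) ^ s) IH => x y IH.
have : (q + 1) * ((q + s) * x) <= (q + 1) * (q * y) by rewrite leq_mul2l IH orbT.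
nia.
Qed.

Lemma wf_laakso n : wfg (laakso n).
Proof. by apply: wf_refine => u v; rewrite inE => /eqP[-> ->]. Qed.

Lemma conn_laakso n : connected (laakso n).
Proof.
apply: conn_refine => [u v|]; first by rewrite inE => /eqP[-> ->].
by case=> [|[|x]] // _; [exists [::]|exists [:: 1]].
Qed.

(** The hypothesis compares two pairs of points, so the scale of the embedding disappears and
    everything stays in [nat]. Over [J] levels the maximal edge stretch [a] falls by a factor of at
    most [4 ^ J - 1], whereas a bilipschitz map needs [4 ^ J] on average, up to the constant [C]. *)
Lemma laakso_not_into_diamond C : exists n, forall m (F : nat -> nat),
  (forall x, x < nv (laakso n) -> F x < nv (diamond m)) ->
  0 < dd m (F 0) (F 1) ->
  (forall x y z w, x < nv (laakso n) -> y < nv (laakso n) ->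
    z < nv (laakso n) -> w < nv (laakso n) ->
    dd m (F x) (F y) * gdist (laakso n) z w <=
    C * gdist (laakso n) x y * dd m (F z) (F w)) -> False.
Proof.
(* The factor 100 is the ratio of [L] to [R] required by [frame]; any [j] satisfying [jC] would
   do. *)
pose j := 100 * (5 * C + 1); have jC : 100 * (5 * C + 1) <= 4 ^ j.
  exact: ltnW (ltn_expl _ _).
pose J := j.+2; have [q qE] : exists q, 4 ^ J = q + 1.
  by exists (4 ^ J).-1; rewrite addn1 prednK // expn_gt0.
have q0 : 0 < q.
  by have := leq_pexp2l (isT : 0 < 4) (isT : 1 <= J); rewrite qE; lia.
(* This [s] gives [q * C < q + s], as the final comparison requires. *)
pose s := C * q; exists (s * J) => m F Fm F01 dist; set n := s * J in Fm dist.
pose a i := \max_(e <- es (laakso (i * J))) dd m (F e.1) (F e.2).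
have le_a i e : e \in es (laakso (i * J)) -> dd m (F e.1) (F e.2) <= a i.
  by move=> eG; apply: (leq_bigmax_seq _ eG).
have split_n i : i <= s -> exists2 h, h = (s - i) * J & laakso n = refine h (laakso (i * J)).
  by move=> il; exists ((s - i) * J); rewrite // /laakso -iterD -mulnDl subnK.
have nv_le i x : i <= s -> x < nv (laakso (i * J)) -> x < nv (laakso n).
  by move=> /split_n[h _ ->] /leq_trans; apply; apply: nv_refine.
have a0 : 0 < a 0 by apply: leq_trans F01 _; apply: (le_a 0 (0, 1)).
(* Otherwise an edge attaining [a i] would be stretched to more than [(4 ^ J - 1) * a i.+1], against
   [not_stretched]. *)
have drop i : i < s -> a i <= q * a i.+1.
  move=> il; rewrite leqNgt; apply/negP => big.
  have ai0 : 0 < a i by lia.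
  have [[u v] uv aE] := bigmax_attained _ _ _ ai0.
  rewrite -/(a i) [(u, v).1]/= [(u, v).2]/= in aE.
  have wG := wf_laakso (i * J); have cG := conn_laakso (i * J).
  have GJ : refine J (laakso (i * J)) = laakso (i.+1 * J) by rewrite /laakso -iterD mulSn.
  have [h _ nE] := split_n i.+1 il.
  have sF : stretch m C (a i.+1) F (laakso (i * J)) J h.
    rewrite /stretch GJ -nE; split=> // [b c bc|x y xn yn]; first exact: le_a _ (b, c) bc.
    (* The lower bound comes from comparing an edge that attains [a i.+1], of length at most
       [4 ^ h], with the pair [x], [y]. *)
    have [->//|/bigmax_attained[[b c] bc bE]] := posnP (a i.+1).
    rewrite -/(a i.+1) [(b, c).1]/= [(b, c).2]/= in bE; rewrite bE.
    have [bn cn] := wf_laakso _ _ _ bc.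
    apply: leq_trans (dist b c x y (nv_le _ _ il bn) (nv_le _ _ il cn) xn yn) _.
    rewrite leq_mul2r leq_mul2l nE; apply/orP; right; apply/orP; right.
    by apply: refine_gdist_le => //; [apply: wf_laakso|apply: conn_laakso].
  have [_ _ uv_le] := stretch_edge _ _ _ _ _ _ _ _ _ wG sF uv.
  have M0 : 0 < a i.+1.
    rewrite lt0n; apply/eqP => M0; move: uv_le; rewrite M0 muln0; lia.
  apply: (not_stretched _ _ _ _ _ _ _ _ _ wG cG sF uv M0 jC).
  by rewrite -/J qE mulnDl mul1n; lia.
have drops i : i <= s -> a 0 <= q ^ i * a i.
  elim: i => [|i IH] il; first by rewrite mul1n.
  apply: leq_trans (IH (ltnW il)) _; rewrite expnSr -mulnA leq_mul2l drop //.
  by rewrite orbT.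
have as0 : 0 < a s.
  by rewrite lt0n; apply/eqP => as0; have := drops s (leqnn s); rewrite as0 muln0; lia.
have [[b c] bc asE] := bigmax_attained _ _ _ as0.
rewrite -/(a s) [(b, c).1]/= [(b, c).2]/= in asE.
have [b_n c_n] := wf_laakso _ _ _ bc.
have v0 : 0 < nv (laakso n) by apply: leq_trans (nv_refine n _).
have v1 : 1 < nv (laakso n) by apply: leq_trans (nv_refine n _).
have g01 : 4 ^ n <= gdist (laakso n) 0 1.
  apply: refine_gdist_ge => //; [exact: (wf_laakso 0)|exact: (conn_laakso 0)].
have gbc : gdist (laakso n) b c <= 1.
  by apply: adj_gdist; [exact: wf_laakso|rewrite /adj bc].
have h1 := dist b c 0 1 b_n c_n v0 v1.
have h2 : dd m (F 0) (F 1) <= a 0 by exact: (le_a 0 (0, 1)).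
rewrite -asE in h1.
have h3 := drops s (leqnn s).
have h4 : a s * 4 ^ n <= C * a 0.
  apply: leq_trans (_ : _ <= a s * gdist (laakso n) 0 1) _; first by rewrite leq_mul2l g01 orbT.
  apply: leq_trans h1 _; rewrite -mulnA leq_mul2l; apply/orP; right.
  have : gdist (laakso n) b c * dd m (F 0) (F 1) <= 1 * dd m (F 0) (F 1).
    by rewrite leq_mul2r gbc orbT.
  by rewrite mul1n => /leq_trans; apply.
(* Since [4 ^ n] is [(q + 1) ^ s], this bound contradicts Bernoulli's inequality. *)
have h5 : 4 ^ n <= C * q ^ s.
  rewrite -(leq_pmul2l as0); apply: leq_trans h4 _.
  by rewrite mulnCA leq_mul2l [a s * _]mulnC h3 orbT.
have h6 := exp_succ_lower q s; have qs : 0 < q ^ s by rewrite expn_gt0 q0.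
move: h5; rewrite /n mulnC expnM qE leqNgt => /negP; apply.
rewrite -(ltn_pmul2l q0); apply: leq_trans h6.
by rewrite mulnA /s [q * C]mulnC ltn_mul2r qs; lia.
Qed.

(** * Passage from real to natural constants *)

Local Open Scope ring_scope.

Theorem theorem1p6 (R : realType) :
  ~ exists (C : R) (m : nat -> nat)
      (f : forall n : nat, 'I_(nv (laakso n)) -> 'I_(nv (diamond (m n)))),
      1 <= C /\
      forall n : nat, exists r : R, 0 < r /\
        forall u v : 'I_(nv (laakso n)),
          r * (gdist (laakso n) u v)%:R
            <= (gdist (diamond (m n)) (f n u) (f n v))%:R
          /\ (gdist (diamond (m n)) (f n u) (f n v))%:R
            <= C * r * (gdist (laakso n) u v)%:R.
Proof.
move=> [C [m [f [C1 emb]]]].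
have C0 : 0 <= C by apply: le_trans C1.
(* A natural constant [D] above [C] is enough, because enlarging the constant weakens the upper
   bound. *)
have := archi_boundP C0; move: (Num.bound C) => D CD.
have [n no_emb] := laakso_not_into_diamond D; have [r [r0 fr]] := emb n.
pose F x : nat := if insub x is Some u then f n u else 0%N.
have FE (u : 'I_(nv (laakso n))) : F u = f n u by rewrite /F valK.
apply: (no_emb (m n) F).
- by move=> x xn; rewrite (FE (Ordinal xn)).
- have v0 : (0 < nv (laakso n))%N by apply: leq_trans (nv_refine n _).
  have v1 : (1 < nv (laakso n))%N by apply: leq_trans (nv_refine n _).
  have := (fr (Ordinal v0) (Ordinal v1)).1.
  rewrite -!FE /= -(ltr0n R); apply: lt_le_trans; rewrite mulr_gt0 // ltr0n.
  apply: leq_trans (_ : 0 < 4 ^ n)%N _; first by rewrite expn_gt0.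
  apply: refine_gdist_ge => //; [exact: (wf_laakso 0)|exact: (conn_laakso 0)].
move=> x y z w xn yn zn wn.
have := (fr (Ordinal xn) (Ordinal yn)).2; have := (fr (Ordinal zn) (Ordinal wn)).1.
rewrite -!FE /= => zw xy; rewrite -(ler_nat R) !natrM.
(* The factor [r] from the upper bound for [x], [y] is absorbed by the lower bound for [z], [w]. *)
apply: le_trans (ler_wpM2r (ler0n _ _) xy) _.
rewrite mulrAC -[C * r * _]mulrA mulrAC.
apply: ler_pM zw; rewrite ?mulr_ge0 ?ler0n ?(ltW r0) //.
by rewrite ler_wpM2r ?ler0n // ltW.
Qed.
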